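(* Let $X$ be a locally connected continuum. Suppose that $NC^{*}(X)$ is a closed subset of $C(X)$. Then $X$ is either an arc or a simple closed curve.
   Context: A continuum is a compact connected metric space with more than one point. A subcontinuum of $X$ is a nonempty closed connected subset of $X$ (one-point sets are allowed). $C(X)$ denotes the hyperspace of all subcontinua of $X$, endowed with the Hausdorff metric (equivalently, the Vietoris topology). $NC^{*}(X)=\{A\in C(X): X\setminus A \text{ is connected}\}$, with the subspace topology from $C(X)$. The empty set counts as connected, so $X\in NC^{*}(X)$. An arc is a space homeomorphic to $[0,1]$; a simple closed curve is a space homeomorphic to the unit circle in the plane. *)

(* Defs.v *)
From HB Require Import structures.
From mathcomp Require Import all_boot all_order all_algebra.
From mathcomp Require Import all_classical all_reals all_analysis.
Set Implicit Arguments. Unset Strict Implicit. Unset Printing Implicit Defensive.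
Import Order.TTheory GRing.Theory Num.Theory.
Import numFieldNormedType.Exports.
Local Open Scope classical_set_scope.
Local Open Scope ring_scope.

Section Defs.
Context {T : topologicalType}.

Definition locally_connected_space : Prop :=
  forall (x : T) (U : set T), open U -> U x ->
    exists V : set T, [/\ open V, connected V, V x & V `<=` U].

Definition subcontinuum (A : set T) : Prop :=
  [/\ A !=set0, closed A & connected A].

Definition NCstar (A : set T) : Prop :=
  subcontinuum A /\ connected (~` A).

Definition vietoris_basic (n : nat) (U : nat -> set T) (B : set T) : Prop :=
  B `<=` \bigcup_(i in [set i | (i < n)%N]) U i /\
  (forall i, (i < n)%N -> B `&` U i !=set0).

Definition vietoris_closure (P : set T -> Prop) (A : set T) : Prop :=
  forall (n : nat) (U : nat -> set T),
    (forall i, (i < n)%N -> open (U i)) ->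
    vietoris_basic n U A -> exists B, P B /\ vietoris_basic n U B.

Definition closed_in_CX (P : set T -> Prop) : Prop :=
  forall A, subcontinuum A -> vietoris_closure P A -> P A.

End Defs.

Definition is_arc {R : realType} (T : topologicalType) : Prop :=
  exists (f : R -> T) (g : T -> R),
    [/\ {within `[0, 1]%classic, continuous f}, continuous g,
        (forall x, g x \in `[0, 1]%R),
        (forall x, f (g x) = x) &
        (forall t, t \in `[0, 1]%R -> g (f t) = t)].

Definition unit_circle {R : realType} : set (R * R) :=
  [set p | p.1 ^+ 2 + p.2 ^+ 2 = 1].

Definition is_simple_closed_curve {R : realType} (T : topologicalType) : Prop :=
  exists (f : R * R -> T) (g : T -> R * R),
    [/\ {within (@unit_circle R), continuous f}, continuous g,
        (forall x, unit_circle (g x)),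
        (forall x, f (g x) = x) &
        (forall p, unit_circle p -> g (f p) = p)].

(* Main.v *)
Require Import Defs.
From HB Require Import structures.
From mathcomp Require Import all_boot all_order all_algebra.
From mathcomp Require Import all_classical all_reals all_analysis.
From mathcomp Require Import ring lra.
Set Implicit Arguments. Unset Strict Implicit. Unset Printing Implicit Defensive.
Import Order.TTheory GRing.Theory Num.Theory.
Import numFieldNormedType.Exports.
Local Open Scope classical_set_scope.
Local Open Scope ring_scope.

(** The key fact is that separation of two points by continua is not created in a
limit: if an up-directed family of continua [K] never separates [q] from [x], fill
each [K] with the components of its complement that miss [q]; the filled sets lie in
[NCstar], hence so does the closure of their union, whose connected complement
contains [q] and [x].  Applied to a chain of proper subcontinua of a minimal
separating continuum, it shows that a continuum separating two points contains a
single point separating them.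

If [X] has a cut point, it has two noncut points [p], [q] separated by it.  A third
noncut point [x] on the side of [p], say, is impossible: take a minimal closed set
containing [p] and [x] but not [q] whose boundary is one point [b]; small continua
next to [b] inside this set already separate both [p] and [x] from [q], so a point
closer to [p] and [x] does.  Hence every other point separates [p] from [q], and [X]
is an arc.

If [X] has no cut point, no continuum separates [X].  Then any two points [p], [q]
separate [X], since otherwise a continuum missing them could contain the boundary of
a neighborhood of [p].  So [X] is the union of two continua meeting in [p] and [q],
each of which turns out to be an arc.

An arc is recognized as a locally connected continuum all of whose points separate
two ends; it is parametrized by a weighted sum of running suprema, along the
separation order, of functions peaking at the points of finer and finer finite nets. *)

(** * Connected sets: separations by open or closed pieces *)

Section Connectedness.
Context {T : topologicalType}.
Implicit Types A C P Q O : set T.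

Lemma connected_sub_open C P Q : connected C -> open P -> open Q ->
  C `<=` P `|` Q -> C `&` P `&` Q = set0 -> C `&` P !=set0 -> C `<=` P.
Proof.
move=> cC oP oQ CPQ CPQ0 CP.
suff <- : C `&` P = C by move=> x [].
apply: cC => //; first by exists P.
exists (~` Q); first exact: open_closedC.
apply/seteqP; split => x [Cx Px]; split => //.
  by move=> Qx; have : (C `&` P `&` Q) x by []; rewrite CPQ0.
by have [|] := CPQ _ Cx.
Qed.

Lemma connected_sub_closed C P Q : connected C -> closed P -> closed Q ->
  C `<=` P `|` Q -> C `&` P `&` Q = set0 -> C `&` P !=set0 -> C `<=` P.
Proof.
move=> cC cP cQ CPQ CPQ0 CP.
suff <- : C `&` P = C by move=> x [].
apply: cC => //; last by exists P.
exists (~` Q); first exact: closed_openC.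
apply/seteqP; split => x [Cx Px]; split => //.
  by move=> Qx; have : (C `&` P `&` Q) x by []; rewrite CPQ0.
by have [|] := CPQ _ Cx.
Qed.

Lemma closed_connectedP A : closed A ->
  (forall P Q, closed P -> closed Q -> A = P `|` Q -> P `&` Q = set0 ->
     P !=set0 -> Q !=set0 -> False) ->
  connected A.
Proof.
move=> cA H B B0 [C oC BC] [D cD BD].
apply: contrapT => BA.
have CD x : A x -> C x <-> D x.
  by move=> Ax; split => [Cx|Dx];
    [have : B x by rewrite BC|have : B x by rewrite BD];
    [rewrite BD|rewrite BC] => -[].
apply: (H (A `&` D) (A `&` ~` C)).
- exact: closedI.
- by apply: closedI => //; exact: open_closedC.
- apply/seteqP; split => x; last by case => -[].
  by move=> Ax; have [/CD|] := pselect (C x); [move=> /(_ Ax); left|right].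
- by rewrite -subset0 => x [[Ax /(CD _ Ax) Cx] [_ /(_ Cx)]].
- by rewrite -BD.
- apply/set0P/eqP => AC0; apply: BA; rewrite BC; apply/seteqP; split; first by move=> x [].
  move=> x Ax; split => //; apply: contrapT => nC.
  by have : (A `&` ~` C) x by []; rewrite AC0.
Qed.

Lemma connected_clopen_setT A : connected [set: T] -> open A -> closed A ->
  A !=set0 -> A = setT.
Proof. by move=> cT oA cA A0; apply: cT => //; exists A => //; rewrite setTI. Qed.

Lemma connected_boundary C O : connected C -> open O -> C `&` O !=set0 ->
  ~ C `<=` O -> C `&` (closure O `\` O) !=set0.
Proof.
move=> cC oO CO nCO; apply: contrapT => H; apply: nCO.
have CcO x : C x -> closure O x -> O x.
  by move=> Cx cOx; apply: contrapT => nOx; apply: H; exists x.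
apply: (@connected_sub_open C O (~` closure O)) => //.
- exact/closed_openC/closed_closure.
- by move=> x Cx; have [/(CcO _ Cx)|] := pselect (closure O x); [left|right].
- by rewrite -subset0 => x [[_ Ox]]; apply; exact: subset_closure.
Qed.

Lemma connected_between A B : connected A -> A `<=` B -> B `<=` closure A ->
  connected B.
Proof.
move=> cA AB BcA U U0 [C oC UC] [D cD UD].
have CD x : B x -> C x <-> D x.
  move=> Bx; split => [Cx|Dx].
    have : U x by rewrite UC; split.
    by rewrite UD => -[].
  have : U x by rewrite UD; split.
  by rewrite UC => -[].
have AD : A `<=` D.
  suff <- : A `&` C = A by move=> x [/AB/CD[+ _] Cx]; exact.
  apply: cA.
  - move: U0; rewrite UC => -[x [Bx Cx]].
    by apply: (BcA _ Bx C); exact: open_nbhs_nbhs.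
  - by exists C.
  - exists D => //; apply/seteqP; split => x [Ax Ex]; split => //.
      by apply/CD => //; exact: AB.
    by apply/CD => //; exact: AB.
rewrite UD; apply/setIidPl => x /BcA; rewrite [D](closure_id _).1//.
exact: closureS.
Qed.

Lemma connected_adjoin A x : connected A -> closure A x -> connected (A `|` [set x]).
Proof.
move=> cA Ax; apply: (connected_between cA) => [y Ay|]; first by left.
by move=> y [/subset_closure//|->].
Qed.

End Connectedness.

(** * Maximal and minimal sets from Zorn's lemma *)

Lemma maximal_set_exists (T : Type) (P : set (set T)) (A0 : set T) : P A0 ->
  (forall F, F `<=` P -> F !=set0 -> total_on F subset ->
     exists2 B, P B & forall A, F A -> A `<=` B) ->
  exists2 M, P M & forall B, P B -> M `<=` B -> B = M.
Proof.
move=> PA0 chainP; pose R (a b : {A | P A}) := `[< sval a `<=` sval b >].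
have [t||||[M PM] maxM] := @Zorn _ R.
- exact/asboolP.
- move=> r s t /asboolP rs /asboolP st; apply/asboolP.
  exact: subset_trans st.
- move=> [s Ps] [t Pt] /asboolP/= st /asboolP/= ts; apply: eq_exist.
  exact/seteqP.
(* The empty chain has the bound [A0]; nonempty ones are bounded by [chainP]. *)
- move=> F totF; have [[f Ff]|F0] := pselect (F !=set0); last first.
    by exists (exist _ A0 PA0) => s Fs; exfalso; apply: F0; exists s.
  have [_ [a Fa <-]|||B PB FB] := chainP (sval @` F).
  + exact: svalP.
  + by exists (sval f); exists f.
  + move=> _ _ [a Fa <-] [b Fb <-].
    by have [/asboolP|/asboolP] := totF _ _ Fa Fb; [left|right].
  + by exists (exist _ B PB) => s Fs; apply/asboolP; apply: FB; exists s.
exists M => // B PB MB.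
by have /(congr1 sval) := maxM (exist _ B PB) (asboolT MB).
Qed.

Lemma minimal_set_exists (T : Type) (P : set (set T)) (A0 : set T) : P A0 ->
  (forall F, F `<=` P -> F !=set0 -> total_on F subset ->
     P (\bigcap_(A in F) A)) ->
  exists2 M, P M & forall B, P B -> B `<=` M -> B = M.
Proof.
move=> PA0 chainP.
have [||M PM maxM] := @maximal_set_exists T [set A | P (~` A)] (~` A0).
- by rewrite /= setCK.
- move=> F FP [f Ff] totF; exists (~` (\bigcap_(A in [set ~` B | B in F]) A)).
    rewrite /= setCK; apply: chainP.
    + by move=> _ [B FB <-]; exact: FP.
    + by exists (~` f); exists f.
    + move=> _ _ [A FA <-] [B FB <-].
      by have [AB|AB] := totF _ _ FA FB; [right|left]; exact: subsetC.
  by move=> A FA x Ax /(_ (~` A)); apply => //; exists A.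
exists (~` M) => // B PB BM.
rewrite -(maxM (~` B)) ?setCK//= ?setCK//.
by apply/subsetCr.
Qed.

(** * Compact Hausdorff spaces: directed intersections and boundary bumping *)

Section CompactHausdorff.
Context {X : topologicalType} (hX : hausdorff_space X) (cpt : compact [set: X]).
Implicit Types A C P Q O K : set X.

Definition down_directed (F : set (set X)) :=
  forall A B, F A -> F B -> exists2 C, F C & C `<=` A `&` B.

(** If no member lay inside [O], the traces on the complement of [O] would generate a proper filter;
    a cluster point of it lies in every member and outside [O]. *)
Lemma compact_down_directed (F : set (set X)) O : F !=set0 -> down_directed F ->
  (forall A, F A -> closed A) -> open O -> \bigcap_(A in F) A `<=` O ->
  exists2 A, F A & A `<=` O.
Proof.
move=> [f Ff] dF clF oO FO; apply: contrapT => nAO.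
have nonempty A : F A -> A `&` ~` O !=set0.
  move=> FA; apply: contrapT => AO0; apply: nAO; exists A => // x Ax.
  by apply: contrapT => nOx; apply: AO0; exists x.
pose G := filter_from F (fun A => A `&` ~` O).
have PG : ProperFilter G.
  apply: filter_from_proper => //; apply: filter_from_filter; first by exists f.
  move=> A B FA FB; have [C FC CAB] := dF _ _ FA FB.
  by exists C => // x [/CAB[Ax Bx] nOx].
have [x [_ clGx]] := cpt PG filterT.
have : (\bigcap_(A in F) A) x.
  move=> A FA; apply: (clF A) => // B nB.
  have [|y [[Ay _] By]] := clGx (A `&` ~` O) B _ nB; first by exists A.
  by exists y.
move=> /FO Ox.
have [|y [[_ nOy] Oy]] := clGx (f `&` ~` O) O _ (open_nbhs_nbhs (conj oO Ox)).
  by exists f.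
by [].
Qed.

Lemma total_down_directed (F : set (set X)) : total_on F subset -> down_directed F.
Proof.
by move=> tF A B FA FB; have [AB|BA] := tF _ _ FA FB; [exists A|exists B] => // x ?;
  split => //; [exact: AB|exact: BA].
Qed.

Lemma closed_point (x : X) : closed [set x].
Proof. exact/accessible_closed_set1/hausdorff_accessible. Qed.

Lemma closed_sub_open A O : closed A -> open O -> A `<=` O ->
  exists G, [/\ open G, A `<=` G & closure G `<=` O].
Proof.
move=> cA oO AO; have AnO : set_nbhs A O by apply/set_nbhsP; exists O; split.
have [B AB BO] := compact_normal hX cpt cA AnO.
have /set_nbhsP[G [oG AG GB]] := AB; exists G; split => //.
by apply: subset_trans BO; exact: closureS.
Qed.

Lemma point_sub_open (x : X) O : open O -> O x ->
  exists G, [/\ open G, G x & closure G `<=` O].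
Proof.
move=> oO Ox; have [|G [oG xG GO]] := @closed_sub_open [set x] O (@closed_point x) oO.
  by move=> _ ->.
by exists G; split => //; exact: xG.
Qed.

Lemma closed_disjoint_open P Q : closed P -> closed Q -> P `&` Q = set0 ->
  exists U V, [/\ open U, open V, P `<=` U, Q `<=` V & U `&` V = set0].
Proof.
move=> cP cQ PQ0.
have [||G [oG PG GQ]] := @closed_sub_open P (~` Q) cP; first exact: closed_openC.
  exact/disjoints_subset.
exists G, (~` closure G); split => //.
- exact/closed_openC/closed_closure.
- by apply/subsetCr.
- by rewrite -subset0 => x [/subset_closure].
Qed.

(** Disjoint closed pieces of the intersection have disjoint open neighborhoods [U] and [V], and by
    compactness some member already lies in their union. So it is enough to examine separations of
    members. *)
Lemma bigcap_connected (F : set (set X)) : F !=set0 -> down_directed F ->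
  (forall A, F A -> closed A) ->
  (forall A U V, F A -> open U -> open V -> U `&` V = set0 -> A `<=` U `|` V ->
     (\bigcap_(B in F) B) `<=` U \/ (\bigcap_(B in F) B) `<=` V) ->
  connected (\bigcap_(A in F) A).
Proof.
move=> F0 dF clF splitF; apply: closed_connectedP; first exact: closed_bigI.
move=> P Q cP cQ NPQ PQ0 [x Px] [y Qy].
have [U [V [oU oV PU QV UV0]]] := closed_disjoint_open cP cQ PQ0.
have [|A FA AUV] := compact_down_directed F0 dF clF (openU oU oV).
  by rewrite NPQ => z [/PU|/QV]; [left|right].
have disj z : U z -> V z -> False.
  by move=> Uz Vz; have : (U `&` V) z by []; rewrite UV0.
have [NU|NV] := splitF A U V FA oU oV UV0 AUV.
- apply: (disj y); last exact: QV.
  by apply: NU; rewrite NPQ; right.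
- apply: (disj x); first exact: PU.
  by apply: NV; rewrite NPQ; left.
Qed.

Lemma total_bigcap_subcontinuum (F : set (set X)) : F !=set0 ->
  total_on F subset -> F `<=` subcontinuum -> subcontinuum (\bigcap_(A in F) A).
Proof.
move=> F0 tF FS; have clF A : F A -> closed A by move=> /FS[].
have dF := total_down_directed tF.
split; last 1 first.
- apply: bigcap_connected => // A U V FA oU oV UV0 AUV.
  have [A0 _ cA] := FS _ FA.
  have sA : \bigcap_(B in F) B `<=` A by move=> z /(_ _ FA).
  have [[z [Az Uz]]|AU0] := pselect (A `&` U !=set0).
    left; apply: (subset_trans sA); apply: (connected_sub_open cA oU oV) => //.
      by rewrite -setIA UV0 setI0.
    by exists z.
  right => z /sA Az; have [Uz|//] := AUV _ Az.
  by exfalso; apply: AU0; exists z.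
- apply: contrapT => I0.
  have [|A FA] := compact_down_directed F0 dF clF (@open0 X).
    by move=> z Iz; apply: I0; exists z.
  by have [[z Az] _ _] := FS _ FA => /(_ _ Az).
- exact: closed_bigI.
Qed.

(* Boundary bumping: the component of [M] in [closure G `&` K] is the intersection of
   its clopen neighborhoods, and one of these inside [G] would be clopen in [K]. *)
Lemma no_maximal_proper_subcontinuum K M : subcontinuum K -> subcontinuum M ->
  M `<=` K -> M <> K ->
  exists N, [/\ subcontinuum N, M `<=` N, N `<=` K, N <> K & N <> M].
Proof.
move=> [K0 cK conK] [M0 cM conM] MK nMK.
have [z [Kz nMz]] : exists z, K z /\ ~ M z.
  apply: contrapT => H; apply: nMK; apply/seteqP; split => // z Kz.
  by apply: contrapT => nMz; apply: H; exists z.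
have [||G [oG MG Gz]] := @closed_sub_open M (~` [set z]) cM.
- exact/closed_openC/closed_point.
- by move=> x Mx xz; apply: nMz; rewrite -xz.
pose H := closure G `&` K.
have cH : closed H by apply: closedI => //; exact: closed_closure.
pose F := [set Q | [/\ closed Q, closed (H `\` Q), M `<=` Q & Q `<=` H]].
have FH : F H.
  split => //; first by rewrite setDv; exact: closed0.
  by move=> x Mx; split; [apply: subset_closure; exact: MG|exact: MK].
have dF : down_directed F.
  move=> A B [cA cHA MA AH] [cB cHB MB BH]; exists (A `&` B) => //; split.
  - exact: closedI.
  - by rewrite setDIr; exact: closedU.
  - by move=> x Mx; split; [exact: MA|exact: MB].
  - by move=> x [/AH].
have clF A : F A -> closed A by case.
pose N := \bigcap_(Q in F) Q.
have MN : M `<=` N by move=> x Mx Q [_ _ MQ _]; exact: MQ.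
have NH : N `<=` H by move=> x /(_ _ FH).
have conN : connected N.
  apply: bigcap_connected => //; first by exists H.
  (* When [M] meets [U], a member covered by [U] and [V] stays in [F] after its part in [V] is
     removed. *)
  have gen A U V : F A -> open U -> open V -> U `&` V = set0 -> A `<=` U `|` V ->
      M `&` U !=set0 -> N `<=` U.
    move=> [cA cHA MA AH] oU oV UV0 AUV MU.
    have disj x : U x -> V x -> False.
      by move=> Ux Vx; have : (U `&` V) x by []; rewrite UV0.
    have MsU : M `<=` U.
      apply: (connected_sub_open conM oU oV) => //; first exact: subset_trans AUV.
      by rewrite -setIA UV0 setI0.
    have FAU : F (A `&` ~` V).
      split.
      - by apply: closedI => //; exact: open_closedC.
      - have -> : H `\` (A `&` ~` V) = (H `\` A) `|` (H `&` ~` U `&` A).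
          apply/seteqP; split => x.
            move=> [Hx nAV]; have [Ax|nAx] := pselect (A x); last by left.
            right; split => //; split => // Ux; apply: nAV; split => //.
            exact: disj.
          move=> [[Hx nAx]|[[Hx nUx] Ax]]; split => //; first by case.
          by move=> [_ nVx]; have [|] := AUV _ Ax.
        apply: closedU => //; apply: closedI => //; apply: closedI => //.
        exact: open_closedC.
      - move=> x Mx; split; first exact: MA.
        by move=> Vx; apply: (disj x) => //; exact: MsU.
      - by move=> x [/AH].
    by move=> x /(_ _ FAU)[Ax nVx]; have [|] := AUV _ Ax.
  move=> A U V FA oU oV UV0 AUV; have [m Mm] := M0.
  have [Um|Vm] : (U `|` V) m by apply: AUV; case: FA => _ _ + _; exact.
    by left; apply: (gen A U V FA) => //; exists m.
  by right; apply: (gen A V U FA oV oU); rewrite 1?[V `&` U]setIC 1?[V `|` U]setUC//; exists m.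
exists N; split => //.
- split => //; last exact: closed_bigI.
  by have [m /MN Nm] := M0; exists m.
- by move=> x /NH[].
- by move=> NK; have /NH[/Gz/(_ erefl)] : N z by rewrite NK.
move=> NM.
have [||Q [cQ cHQ MQ QH] QG] := @compact_down_directed F G _ dF clF oG.
- by exists H.
- by rewrite -/N NM.
suff KQ : K `<=` Q by have /QH[/Gz/(_ erefl)] := KQ _ Kz.
apply: (@connected_sub_closed _ K Q (H `\` Q `|` (K `&` ~` G))) => //.
- by apply: closedU => //; apply: closedI => //; exact: open_closedC.
- move=> x Kx; have [Qx|nQx] := pselect (Q x); first by left.
  right; have [Gx|nGx] := pselect (G x); last by right.
  by left; split => //; split => //; exact: subset_closure.
- by rewrite -subset0 => x [[Kx Qx] [[_ /(_ Qx)//]|[_ /(_ (QG _ Qx))]]].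
- by have [m Mm] := M0; exists m; split; [exact: MK|exact: MQ].
Qed.

End CompactHausdorff.

(** * Unions of up-directed families *)

Definition up_directed (T : Type) (F : set (set T)) :=
  forall A B, F A -> F B -> exists2 C, F C & A `|` B `<=` C.

Lemma up_directed_total (T : Type) (F : set (set T)) :
  total_on F subset -> up_directed F.
Proof.
move=> tF A B FA FB; have [AB|BA] := tF _ _ FA FB; [exists B|exists A] => //.
  by move=> x [/AB|].
by move=> x [|/BA].
Qed.

(** Discarding the members that miss a fixed point [a] of [A0] keeps the union, since each member
    lies in one that also contains [A0]. *)
Lemma up_directed_connected (T : topologicalType) (F : set (set T)) :
  up_directed F -> (forall A, F A -> A !=set0 /\ connected A) ->
  connected (\bigcup_(A in F) A).
Proof.
move=> dF cF; have [->|/set0P[A0 FA0]] := eqVneq F set0.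
  by rewrite bigcup_set0; exact: connected0.
have [[a A0a] _] := cF _ FA0.
have -> : \bigcup_(A in F) A = \bigcup_(A in [set A | F A /\ A a]) A.
  apply/seteqP; split => x [A]; last by move=> [FA _] Ax; exists A.
  move=> FA Ax; have [C FC AC] := dF _ _ FA0 FA.
  by exists C; [split => //; apply: AC; left|apply: AC; right].
apply: bigcup_connected; first by exists a => A [].
by move=> A [/cF[]].
Qed.

(** * Locally connected continua: filling, and enclosing closed sets in subcontinua *)

Section LocallyConnected.
Context {X : topologicalType}.
Context (hX : hausdorff_space X) (cpt : compact [set: X]).
Context (conn : connected [set: X]) (lc : @locally_connected_space X).
Implicit Types (A B C P Q O K V : set X) (x y p q : X).

Lemma open_component O x : open O -> open (connected_component O x).
Proof.
move=> oO; rewrite openE => y Oxy.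
have Oy := connected_component_sub Oxy.
have [W [oW cW Wy WO]] := lc oO Oy.
apply: (filterS _ (open_nbhs_nbhs (conj oW Wy))) => z Wz.
apply: (connected_component_trans Oxy).
by exists W => //; split.
Qed.

Lemma connected_open_nbhs x O : open O -> O x ->
  exists V, [/\ open V, connected V, V x & closure V `<=` O].
Proof.
move=> oO Ox; have [G [oG Gx GO]] := point_sub_open hX cpt oO Ox.
have [V [oV cV Vx VG]] := lc oG Gx; exists V; split => //.
by apply: subset_trans GO; exact: closureS.
Qed.

Lemma subcontinuum1 x : subcontinuum [set x].
Proof. by split; [exists x|exact: closed_point|exact: connected1]. Qed.

Lemma subcontinuum_closure A : A !=set0 -> connected A -> subcontinuum (closure A).
Proof.
move=> [a Aa] cA; split; first by exists a; exact: subset_closure.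
  exact: closed_closure.
exact: connected_closure.
Qed.

(* [K] together with every component of its complement that misses [q]. *)
Definition fill q K := ~` connected_component (~` K) q.

Lemma closed_fill q K : closed K -> closed (fill q K).
Proof.
by move=> cK; apply: open_closedC; apply: open_component; exact: closed_openC.
Qed.

Lemma sub_fill q K : K `<=` fill q K.
Proof. by move=> x Kx /connected_component_sub. Qed.

Lemma fill_mono q K K' : K `<=` K' -> fill q K `<=` fill q K'.
Proof.
move=> KK'; apply: subsetC => x [C [Cq CK cC Cx]]; exists C => //; split => //.
by apply: (subset_trans CK); exact: subsetC.
Qed.

Lemma fill_notin q K : ~ K q -> ~ fill q K q.
Proof. by move=> nKq; apply; exact: connected_component_refl. Qed.

(** The complement is a component, hence connected. If the filled set split, the piece missing [K]
    would be a union of components of the complement of [K], hence open as well as closed in [X]. *)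
Lemma NCstar_fill q K : subcontinuum K -> ~ K q -> NCstar (fill q K).
Proof.
move=> [K0 cK conK] nKq; split; last first.
  by rewrite /fill setCK; exact: component_connected.
have cF := @closed_fill q K cK.
have [k Kk] := K0.
split => //; first by exists k; exact: sub_fill.
apply: closed_connectedP => // P Q cP cQ FPQ PQ0 P0 Q0.
wlog Pk : P Q cP cQ FPQ PQ0 P0 Q0 / P k.
  move=> wl; have : fill q K k by exact: sub_fill.
  rewrite FPQ => -[Pk|Qk]; first exact: (wl P Q).
  by apply: (wl Q P) => //; [rewrite setUC|rewrite setIC].
have KP : K `<=` P.
  apply: (connected_sub_closed conK cP cQ).
  - by rewrite -FPQ; exact: sub_fill.
  - by rewrite -setIA PQ0 setI0.
  - by exists k.
have disj x : P x -> Q x -> False.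
  by move=> Px Qx; have : (P `&` Q) x by []; rewrite PQ0.
have oQ : open Q.
  rewrite openE => z Qz.
  have nKz : (~` K) z by move=> /KP Pz; exact: (disj z).
  have oC : open (connected_component (~` K) z).
    by apply: open_component; exact: closed_openC.
  have Cz := connected_component_refl nKz.
  have CQ : connected_component (~` K) z `<=` Q.
    apply: (connected_sub_closed (@component_connected _ _ _) cQ cP).
    - rewrite setUC -FPQ => w zw qw.
      have : fill q K z by rewrite FPQ; right.
      apply; apply: (connected_component_trans qw).
      exact: connected_component_sym.
    - by rewrite -setIA setIC setIC (setIC Q) PQ0 setI0.
    - by exists z.
  exact: (filterS CQ (open_nbhs_nbhs (conj oC Cz))).
have QT := connected_clopen_setT conn oQ cQ Q0.
by apply: (disj k) => //; rewrite QT.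
Qed.

(* The points having a neighborhood inside a subcontinuum of [V] through a fixed point are clopen in [V]. *)
Lemma subcontinuum_between V H : open V -> connected V -> V !=set0 ->
  closed H -> H `<=` V ->
  exists K, [/\ subcontinuum K, H `<=` K & K `<=` V].
Proof.
move=> oV cV [x0 Vx0] cH HV.
pose F := [set K | [/\ subcontinuum K, K x0 & K `<=` V]].
have FU A B : F A -> F B -> F (A `|` B).
  move=> [[_ cA conA] Ax AV] [[_ cB conB] Bx BV]; split.
  - split; [by exists x0; left|exact: closedU|].
    by apply: connectedU => //; exists x0.
  - by left.
  - by rewrite subUset.
pose S := \bigcup_(K in F) K°.
have oS : open S by apply: bigcup_open => K _; exact: open_interior.
have Sx0 : S x0.
  have [W [oW cW Wx WV]] := connected_open_nbhs oV Vx0.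
  exists (closure W).
    split => //; last exact: subset_closure.
    by apply: subcontinuum_closure => //; exists x0.
  apply: (filterS (@subset_closure _ _)).
  exact: open_nbhs_nbhs.
have VS : V `<=` S.
  suff <- : V `&` S = V by move=> ? [].
  apply: cV; first by exists x0.
    by exists S.
  exists (closure S); first exact: closed_closure.
  apply/seteqP; split => y [Vy Sy]; split => //; first exact: subset_closure.
  have [W [oW cW Wy WV]] := connected_open_nbhs oV Vy.
  have nW := open_nbhs_nbhs (conj oW Wy).
  have [z [[K FK Kz] Wz]] := Sy _ nW.
  exists (K `|` closure W); last first.
    by apply: filterS nW => t /subset_closure; right.
  have [[_ cK conK] Kx KV] := FK; split; last 2 first.
  - by left.
  - by rewrite subUset.
  split; [by exists x0; left|by apply: closedU => //; exact: closed_closure|].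
  apply: connectedU => //; last exact: connected_closure.
  by exists z; split; [exact: interior_subset|exact: subset_closure].
have [K0 FK0] : F !=set0 by case: Sx0 => K FK _; exists K.
have [|||||A [K FK <-] HK] :=
    @compact_down_directed _ cpt [set H `&` ~` K° | K in F] set0.
- by exists (H `&` ~` K0°); exists K0.
- move=> _ _ [K FK <-] [L FL <-]; exists (H `&` ~` (K `|` L)°).
    by exists (K `|` L) => //; exact: FU.
  move=> x [Hx nKL]; split; split => // Ix; apply: nKL.
    by apply: filterS Ix => ? ?; left.
  by apply: filterS Ix => ? ?; right.
- move=> _ [K FK <-]; apply: closedI => //; apply: open_closedC.
  exact: open_interior.
- exact: open0.
- move=> x Ax.
  have Hx : H x by have [|//] := Ax (H `&` ~` K0°); exists K0.
  have [K FK Kx] := VS _ (HV _ Hx).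
  by have [|_ /(_ Kx)] := Ax (H `&` ~` K°); first by exists K.
exists K; case: FK => sK _ KV; split => // x Hx.
apply: interior_subset; apply: contrapT => nKx.
exact: (HK x).
Qed.

(** The union of two subcontinua of [V] may be disconnected, but it is closed and thus enclosed in a
    third one. *)
Lemma up_directed_subcontinua V : open V -> connected V ->
  up_directed [set K | subcontinuum K /\ K `<=` V].
Proof.
move=> oV cV A B [sA AV] [sB BV].
have V0 : V !=set0 by case: sA => -[a /AV]; exists a.
have [||K [sK ABK KV]] := @subcontinuum_between V (A `|` B) oV cV V0.
- by case: sA => _ ? _; case: sB => _ ? _; exact: closedU.
- by rewrite subUset.
by exists K.
Qed.

Lemma bigcup_subcontinua V : V !=set0 -> open V -> connected V ->
  \bigcup_(K in [set K | subcontinuum K /\ K `<=` V]) K = V.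
Proof.
move=> V0 oV cV; apply/seteqP; split; first by move=> x [K [_]] /[apply].
move=> x Vx; exists [set x] => //; split; first exact: subcontinuum1.
by move=> _ ->.
Qed.

(** * Limits of directed families when [NCstar] is closed *)

Section ClosedNCstar.
Context (hcl : closed_in_CX (@NCstar X)).

(** The members converge to the closure of their union in the Vietoris topology: they lie inside it,
    and by directedness one of them meets any finite number of open sets that the closure meets. *)
Lemma NCstar_closure_bigcup (F : set (set X)) : F !=set0 -> up_directed F ->
  F `<=` NCstar -> NCstar (closure (\bigcup_(A in F) A)).
Proof.
move=> [A0 FA0] dF FN; apply: hcl.
  have [[[a A0a] _ _] _] := FN _ FA0.
  apply: subcontinuum_closure; first by exists a; exists A0.
  by apply: up_directed_connected => // A /FN[[]].
move=> n U oU [UA AU].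
suff [B FB BU] : exists2 B, F B & forall i, (i < n)%N -> B `&` U i !=set0.
  exists B; split; first exact: FN.
  split => //; apply: subset_trans UA => x Bx.
  by apply: subset_closure; exists B.
have : (n <= n)%N by [].
move: {1 3}n => m; elim: m => [|m IH] mn; first by exists A0.
have [B FB BU] := IH (ltnW mn).
have [x [clx Ux]] := AU m mn.
have [y [[C FC Cy] Uy]] := clx _ (open_nbhs_nbhs (conj (oU _ mn) Ux)).
have [D FD BCD] := dF _ _ FB FC.
exists D => // i; rewrite ltnS leq_eqVlt => /orP[/eqP ->|im].
  by exists y; split => //; apply: BCD; right.
by have [z [Bz Uz]] := BU _ im; exists z; split => //; apply: BCD; left.
Qed.

(** Let [Z] be the closed union. The filled sets stay inside [fill q Z], so the closure of their
    union misses [q], and its complement is connected. If that closure contained [x], the open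
    component of [x] outside [Z] would meet some [fill q K], although its points are joined to [x],
    and hence to [q], outside [K]. *)
Lemma joined_closure_bigcup (F : set (set X)) q x :
  F !=set0 -> up_directed F -> F `<=` subcontinuum ->
  ~ closure (\bigcup_(A in F) A) q -> ~ closure (\bigcup_(A in F) A) x ->
  (forall K, F K -> connected_component (~` K) q x) ->
  connected_component (~` closure (\bigcup_(A in F) A)) q x.
Proof.
set Z := closure _ => F0 dF FS nZq nZx Fj.
have FZ K : F K -> K `<=` Z by move=> FK y Ky; apply: subset_closure; exists K.
have cZ : closed Z by exact: closed_closure.
pose G := [set fill q K | K in F].
have NB : NCstar (closure (\bigcup_(A in G) A)).
  apply: NCstar_closure_bigcup.
  - by case: F0 => K FK; exists (fill q K); exists K.
  - move=> _ _ [K FK <-] [L FL <-]; have [M FM KLM] := dF _ _ FK FL.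
    exists (fill q M); first by exists M.
    by rewrite subUset; split; apply: fill_mono;
      apply: subset_trans KLM => y; [left|right].
  - move=> _ [K FK <-]; apply: NCstar_fill; first exact: FS.
    by move=> /(FZ _ FK).
have ZB : Z `<=` closure (\bigcup_(A in G) A).
  apply: closureS => y [K FK Ky]; exists (fill q K); first by exists K.
  exact: sub_fill.
exists (~` closure (\bigcup_(A in G) A)).
  split; last by case: NB.
  - have : ~ fill q Z q by exact: fill_notin.
    apply: contra_not; rewrite [fill q Z](closure_id _).1; last exact: closed_fill.
    apply: closureS => y [_ [K FK <-]]; apply: fill_mono; exact: FZ.
  - exact: subsetC.
move=> clx.
have oC : open (connected_component (~` Z) x).
  by apply: open_component; exact: closed_openC.
have Cx := @connected_component_refl _ (~` Z) _ nZx.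
have [y [[_ [K FK <-] Ky] Cy]] := clx _ (open_nbhs_nbhs (conj oC Cx)).
apply: Ky; apply: (connected_component_trans (Fj _ FK)).
case: Cy => C [Cx' CZ cC Cy]; exists C => //; split => //.
by apply: (subset_trans CZ); apply: subsetC; exact: FZ.
Qed.

End ClosedNCstar.
End LocallyConnected.

(** * Components and joined points *)

Section Components.
Context {T : topologicalType}.
Implicit Types (A B C O : set T) (x y : T).

Lemma componentS A B x : A `<=` B ->
  connected_component A x `<=` connected_component B x.
Proof.
move=> AB y [C [Cx CA cC Cy]]; exists C => //; split => //.
exact: subset_trans AB.
Qed.

Lemma component_closed_in A x y : A y -> closure (connected_component A x) y ->
  connected_component A x y.
Proof.
move=> Ay clAy; have [Ax|nAx] := pselect (A x); last first.
  by move: clAy; rewrite connected_component_out// closure0.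
exists (connected_component A x `|` [set y]); last by right.
split; first by left; exact: connected_component_refl.
  by move=> z [/connected_component_sub//|->].
by apply: connected_adjoin => //; exact: component_connected.
Qed.

Lemma not_connected_components A : ~ connected A ->
  exists a b, [/\ A a, A b & ~ connected_component A a b].
Proof.
move=> nA; apply: contrapT => H; apply: nA.
have [->|/set0P[a Aa]] := eqVneq A set0; first exact: connected0.
suff -> : A = connected_component A a by exact: component_connected.
apply/seteqP; split; last exact: connected_component_sub.
by move=> b Ab; apply: contrapT => nab; apply: H; exists a, b.
Qed.

Lemma connected_joined A x y : connected A -> A x -> A y -> connected_component A x y.
Proof. by move=> cA Ax Ay; exists A => //; split. Qed.

Lemma connected_not_split C P Q x y : connected C -> open P -> open Q ->
  C `<=` P `|` Q -> P `&` Q = set0 -> C x -> P x -> C y -> Q y -> False.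
Proof.
move=> cC oP oQ CPQ PQ0 Cx Px Cy Qy.
have /(_ _ Cy) Py : C `<=` P.
  apply: (connected_sub_open cC oP oQ CPQ); last by exists x.
  by rewrite -setIA PQ0 setI0.
by have : (P `&` Q) y by []; rewrite PQ0.
Qed.

End Components.

(** * Separation by continua and by single points *)

Section SeparatingPoints.
Context {X : topologicalType}.
Context (hX : hausdorff_space X) (cpt : compact [set: X]).
Context (conn : connected [set: X]) (lc : @locally_connected_space X).
Context (hcl : closed_in_CX (@NCstar X)).
Implicit Types (A B C E P Q O K V : set X) (x y p q k : X).

Notation joined K := (connected_component (~` K)).

(** A continuum through [q] and [x] inside the open component [V] is disjoint from the intersection,
    hence by compactness from one member. *)
Lemma joined_bigcap (F : set (set X)) q x : F !=set0 -> down_directed F ->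
  (forall A, F A -> closed A) -> joined (\bigcap_(A in F) A) q x ->
  exists2 A, F A & joined A q x.
Proof.
move=> F0 dF clF qx; set V := joined (\bigcap_(A in F) A) q.
have oV : open V.
  by apply: (open_component lc); apply: closed_openC; exact: closed_bigI.
have Vq : V q by apply: connected_component_refl; case: qx => C [Cq CF _ _]; exact: CF.
have [|||||M [[_ cM conM] qxM MV]] := @subcontinuum_between X hX cpt lc V ([set q] `|` [set x]).
- by [].
- exact: component_connected.
- by exists q.
- by apply: closedU; exact: closed_point.
- by move=> _ [->|->].
have [||A FA AM] := @compact_down_directed X cpt F (~` M) F0 dF clF.
- exact: closed_openC.
- by move=> y Fy /MV /connected_component_sub.
exists A => //; exists M; last by apply: qxM; right.
by split => //; [apply: qxM; left|move=> y My /AM].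
Qed.

(* A minimal continuum separating [q] from [x] and [y] is a point: otherwise it is
   the limit of a chain of its proper subcontinua. *)
Lemma separating_point K q x y : subcontinuum K -> ~ K q -> ~ K x -> ~ K y ->
  ~ joined K q x -> ~ joined K q y ->
  exists k, [/\ K k, ~ joined [set k] q x & ~ joined [set k] q y].
Proof.
move=> sK nKq nKx nKy nqx nqy.
pose P := [set L | [/\ subcontinuum L, L `<=` K, ~ joined L q x & ~ joined L q y]].
have [||L [sL LK Lx Ly] minL] := @minimal_set_exists X P K.
- by split.
- move=> F FP F0 tF; have dF := total_down_directed tF.
  have FS : F `<=` subcontinuum by move=> A /FP[].
  have clF A : F A -> closed A by move=> /FS[].
  split; first exact: total_bigcap_subcontinuum.
  + by case: F0 => A FA z /(_ _ FA); case: (FP _ FA) => _ + _ _; exact.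
  + by move=> /(joined_bigcap F0 dF clF)[A /FP[_ _]].
  + by move=> /(joined_bigcap F0 dF clF)[A /FP[_ _ _]].
have [[k Lk] cL conL] := sL.
have [Lk1|Lnk] := pselect (L = [set k]).
  by exists k; split; [exact: LK|rewrite -Lk1|rewrite -Lk1].
exfalso.
pose P2 := [set M | [/\ subcontinuum M, M `<=` L, M <> L & M k]].
(* A chain of proper subcontinua of [L] through [k] never fills up [L], so Zorn's lemma yields a
   maximal one; boundary bumping contradicts this. *)
have [||M [sM ML nML Mk] maxM] := @maximal_set_exists X P2 [set k].
- split; [exact: subcontinuum1|by move=> _ ->|by move=> /esym|by []].
- move=> F FP F0 tF; have dF := up_directed_total tF.
  have FS : F `<=` subcontinuum by move=> A /FP[].
  pose Z := closure (\bigcup_(A in F) A).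
  have ZL : Z `<=` L.
    rewrite [L](closure_id _).1//; apply: closureS => z [A FA Az].
    by have [_ + _ _] := FP _ FA; exact.
  exists Z; last by move=> A FA z Az; apply: subset_closure; exists A.
  have [A0 FA0] := F0; have [[A00 _ _] _ _ A0k] := FP _ FA0.
  split => //; last by apply: subset_closure; exists A0.
    apply: subcontinuum_closure; first by exists k; exists A0.
    by apply: up_directed_connected => // A /FS[].
  move=> eZ.
  (* By minimality of [L], no member of the chain separates [q] from both [x] and [y]. But [L] does,
     so by the limit argument some members, and then a common larger one, do as well. *)
  have nP A : F A -> joined A q x \/ joined A q y.
    move=> FA; have [sA AL nAL Ak] := FP _ FA.
    apply: contrapT => /not_orP[Ax Ay]; apply: nAL; apply: minL => //; split => //.
    exact: subset_trans LK.
  have limF z : ~ K z -> ~ joined L q z -> exists2 A, F A & ~ joined A q z.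
    move=> nKz Lz; apply: contrapT => H; apply: Lz; rewrite -eZ.
    apply: joined_closure_bigcup => //.
    + by rewrite -/Z eZ => /LK.
    + by rewrite -/Z eZ => /LK.
    + by move=> A FA; apply: contrapT => nA; apply: H; exists A.
  have [A FA Ax] := limF _ nKx Lx.
  have [B FB By] := limF _ nKy Ly.
  have [C FC ABC] := dF _ _ FA FB.
  have [jC|jC] := nP _ FC; [apply: Ax|apply: By].
    by apply: componentS jC; apply: subsetC => z Az; apply: ABC; left.
  by apply: componentS jC; apply: subsetC => z Az; apply: ABC; right.
have [N [sN MN NL nNL nNM]] := no_maximal_proper_subcontinuum hX cpt sL sM ML nML.
by apply: nNM; apply: maxM => //; split => //; exact: MN.
Qed.

Lemma connected_setC2_separating_point p q : p <> q ->
  connected (~` [set p; q]) -> exists k, [/\ k <> p, k <> q & ~ joined [set k] p q].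
Proof.
move=> npq cV.
have [||O [oO Op Oq]] := @point_sub_open X hX cpt p (~` [set q]).
- by apply: closed_openC; exact: closed_point.
- by [].
pose H := closure O `\` O.
have nOq : ~ O q by move=> /subset_closure/Oq; apply.
have HV : H `<=` ~` [set p; q].
  by move=> x [clO nOx] [xp|xq]; [apply: nOx; rewrite xp|exact: (Oq _ clO)].
have [h [_ Hh]] : [set: X] `&` H !=set0.
  apply: connected_boundary => //; first by exists p.
  by move=> /(_ q I).
have [||||K [sK HK KV]] := @subcontinuum_between X hX cpt lc (~` [set p; q]) H _ cV.
- apply: closed_openC.
  by apply: closedU; exact: closed_point.
- by exists h; exact: HV.
- by apply: closedI; [exact: closed_closure|exact: open_closedC].
- exact: HV.
have nKp : ~ K p by move=> /KV; apply; left.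
have nKq : ~ K q by move=> /KV; apply; right.
have sKpq : ~ joined K p q.
  move=> [C [Cp CK cC Cq]].
  have [||z [Cz Hz]] := connected_boundary cC oO; first by exists p.
    by move=> /(_ _ Cq).
  exact: (CK z Cz (HK _ Hz)).
have [k [Kk kpq _]] := separating_point sK nKp nKq nKq sKpq sKpq.
by exists k; split => // kE; [apply: nKp|apply: nKq]; rewrite -kE.
Qed.

Lemma closed_component_point q c : closed (joined [set c] q `|` [set c]).
Proof.
move=> y; rewrite closureU => -[cly|cly]; last by right; exact: closed_point cly.
by have [->|yc] := pselect (y = c); [right|left; exact: component_closed_in].
Qed.

Lemma open_fill_point q c : open (fill q [set c] `\` [set c]).
Proof.
rewrite -closedC; suff -> : ~` (fill q [set c] `\` [set c]) = joined [set c] q `|` [set c].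
  exact: closed_component_point.
by rewrite setDE setCI setCK /fill setCK.
Qed.

(** For a minimal [NCstar] set [M] inside [E], each point [z] of [M] has [fill q [set z]] equal to
    [M], so the closure of the complement of [M] adds at most [z]. Two points in [M] would make this
    complement clopen; hence [M] is a single noncut point. *)
Lemma NCstar_noncut_point E q : NCstar E -> ~ E q ->
  exists2 z, E z & connected (~` [set z]).
Proof.
move=> NE nEq; pose P := [set A | NCstar A /\ A `<=` E].
have [||M [NM ME] minM] := @minimal_set_exists X P E.
- by split.
- move=> F FP F0 tF; split; last first.
    by case: F0 => A FA x /(_ _ FA); case: (FP _ FA) => _; exact.
  split; first by apply: total_bigcap_subcontinuum => // A /FP[[]].
  rewrite setC_bigcap.
  have -> : \bigcup_(A in F) ~` A = \bigcup_(B in [set ~` A | A in F]) B.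
    by rewrite bigcup_image.
  apply: up_directed_connected.
    apply: up_directed_total => _ _ [A FA <-] [B FB <-].
    by have [AB|AB] := tF _ _ FA FB; [right|left]; exact: subsetC.
  move=> _ [A FA <-]; have [[_ cA] AE] := FP _ FA; split => //.
  by exists q => /AE.
have [[M0 cM conM] conC] := NM.
have nMq : ~ M q by move=> /ME.
have fillM z : M z -> ~` M = joined [set z] q.
  move=> Mz; rewrite -[RHS]setCK -/(fill q [set z]); congr (~` _); apply/esym.
  have FM : fill q [set z] `<=` M.
    move=> y Fy; apply: contrapT => nMy; apply: Fy; exists (~` M) => //.
    by split => // w nMw wz; apply: nMw; rewrite wz.
  apply: minM => //; split; last exact: subset_trans ME.
  apply: NCstar_fill => //; first exact: subcontinuum1.
  by move=> qz; apply: nMq; rewrite qz.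
have [z Mz] := M0.
have [Mz1|nMz1] := pselect (M = [set z]).
  by exists z; [exact: ME|rewrite -Mz1].
have [z' [Mz' z'z]] : exists z', M z' /\ z' <> z.
  apply: contrapT => H; apply: nMz1; apply/seteqP; split; last by move=> _ ->.
  by move=> y My; apply: contrapT => yz; apply: H; exists y.
have closM w : M w -> closure (~` M) `<=` ~` M `|` [set w].
  move=> Mw; rewrite (fillM _ Mw) [_ `|` _](closure_id _).1.
    by apply: closureS => y; left.
  exact: closed_component_point.
have /connected_clopen_setT : closed (~` M).
  move=> y cly; have [//|yz] := closM _ Mz _ cly.
  have [//|yz'] := closM _ Mz' _ cly.
  by exfalso; apply: z'z; rewrite -yz -yz'.
move=> /(_ conn (closed_openC cM)) MT.
have /MT nMT : ~` M !=set0 by exists q.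
by have : (~` M) z by rewrite nMT.
Qed.

(** * Two noncut points separated from [q] by one and the same point *)

Section ThreeNoncutPoints.
Context (p x q c : X).
Context (npx : p <> x) (noncutp : connected (~` [set p])).
Context (noncutx : connected (~` [set x])).
Context (cqp : ~ joined [set c] q p) (cqx : ~ joined [set c] q x).
Context (cq : c <> q).

(** The last clause says that the boundary of [E] reduces to [b]. *)
Definition one_point_boundary (E : set X) :=
  [/\ closed E, E p, E x, ~ E q & exists2 b, E b & open (E `\ b)].

Lemma one_point_boundary_fill k : k <> q -> ~ joined [set k] q p ->
  ~ joined [set k] q x -> one_point_boundary (fill q [set k]).
Proof.
move=> kq kqp kqx; split => //.
- by apply: closed_fill => //; exact: closed_point.
- by apply: fill_notin => qk; apply: kq; rewrite qk.
- by exists k; [exact: sub_fill|exact: open_fill_point].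
Qed.

(** Suppose the intersection had two boundary points [b] and [y]. Disjoint connected neighborhoods
    of them both meet and leave a common member [C] of the chain, so both contain the only boundary
    point [e] of [C]. *)
Lemma one_point_boundary_bigcap (F : set (set X)) :
  F `<=` one_point_boundary -> F !=set0 -> total_on F subset ->
  one_point_boundary (\bigcap_(A in F) A).
Proof.
move=> FP [A0 FA0] tF; set J := \bigcap_(A in F) A.
have cJ : closed J by apply: closed_bigI => A /FP[].
have Jp : J p by move=> A /FP[].
have nJq : ~ J q by move=> /(_ _ FA0); case: (FP _ FA0).
split => //; first by move=> A /FP[].
have [b [Jb clb]] : exists b, J b /\ closure (~` J) b.
  apply: contrapT => H.
  have oJ : open J.
    rewrite -closedC => y cly; apply: contrapT => /contrapT Jy.
    by apply: H; exists y.
  by apply: nJq; rewrite (connected_clopen_setT conn oJ cJ)//; exists p.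
exists b => //; rewrite -closedC => y cly [Jy yb].
have clJy : closure (~` J) y.
  move=> B nB; have [|w [Jw [Bw wb]]] := cly (B `&` ~` [set b]).
    apply: filterI => //; apply: open_nbhs_nbhs; split => //.
    by apply: closed_openC; exact: closed_point.
  by exists w; split => // Jw'; apply: Jw.
have [|U [V [oU oV bU yV UV0]]] :=
    @closed_disjoint_open X hX cpt [set b] [set y] (@closed_point _ hX b) (@closed_point _ hX y).
  by rewrite -subset0 => z [-> /= yz]; apply: yb.
have [N [oO conO Ob OU]] := lc oU (bU _ erefl).
have [N' [oO' conO' Oy OV]] := lc oV (yV _ erefl).
have [z [nJz Oz]] := clb _ (open_nbhs_nbhs (conj oO Ob)).
have [z' [nJz' Oz']] := clJy _ (open_nbhs_nbhs (conj oO' Oy)).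
have [A [FA nAz]] : exists A, F A /\ ~ A z.
  apply: contrapT => H; apply: nJz => A FA; apply: contrapT => nAz.
  by apply: H; exists A.
have [A' [FA' nAz']] : exists A, F A /\ ~ A z'.
  apply: contrapT => H; apply: nJz' => B FB; apply: contrapT => nBz.
  by apply: H; exists B.
have [C FC CAA'] := total_down_directed tF FA FA'.
have nCz : ~ C z by move=> /CAA'[].
have nCz' : ~ C z' by move=> /CAA'[].
have [cC _ _ _ [e Ce oCe]] := FP _ FC.
have mem_e W u v : connected W -> W u -> C u -> W v -> ~ C v -> W e.
  move=> cW Wu Cu Wv nCv; apply: contrapT => nWe.
  apply: (@connected_not_split _ W (C `\ e) (~` C) u v) => //.
  - exact: closed_openC.
  - move=> w Ww; have [Cw|] := pselect (C w); last by right.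
    by left; split => // we; apply: nWe; rewrite -we.
  - by rewrite -subset0 => w [[]].
  - by split => // ue; apply: nWe; rewrite -ue.
have Oe : N e := mem_e _ _ _ conO Ob (Jb _ FC) Oz nCz.
have O'e : N' e := mem_e _ _ _ conO' Oy (Jy _ FC) Oz' nCz'.
have : (U `&` V) e by split; [exact: OU|exact: OV].
by rewrite UV0.
Qed.

(** If [b] were [p], the connected complement of [p] would be split by the rest of [E], containing
    [x], and the complement of [E], containing [q]; likewise for [x]. *)
Lemma boundary_point_neq E b : one_point_boundary E -> E b -> open (E `\ b) ->
  b <> p /\ b <> x.
Proof.
move=> [cE Ep Ex nEq _] Eb oEb.
have key z w : E z -> E w -> z <> w -> connected (~` [set z]) -> b <> z.
  move=> Ez Ew zw cz bz; subst z.
  apply: (@connected_not_split _ (~` [set b]) (E `\ b) (~` E) w q) => //.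
  - exact: closed_openC.
  - move=> v vb; have [Ev|] := pselect (E v); last by right.
    by left; split.
  - by rewrite -subset0 => v [[]].
  - by move=> wb; apply: zw; rewrite wb.
  - by split => // wb; apply: zw; rewrite wb.
  - by move=> qb; apply: nEq; rewrite qb.
by split; [exact: (key p x)|apply: (key x p) => // xp; apply: npx].
Qed.

(** Near [b], a component [W] of the part of [E] without [b] has [b] in its closure, so this closure
    separates [p] and [x] from [q]. By the limit argument some subcontinuum of [W] does too, and
    [separating_point] shrinks it to a point. *)
Lemma closer_separating_point E b : one_point_boundary E -> E b -> open (E `\ b) ->
  exists k, [/\ (E `\ b) k, ~ joined [set k] q p & ~ joined [set k] q x].
Proof.
move=> PE Eb oS; have [bp bx] := boundary_point_neq PE Eb oS.
have [cE Ep Ex nEq _] := PE; set S := E `\ b in oS *.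
have bq : b <> q by move=> bq; apply: nEq; rewrite -bq.
have [||O [oO conO Ob clO]] := @connected_open_nbhs X hX cpt lc b
    (~` [set p] `&` ~` [set x] `&` ~` [set q]).
- by apply: openI; [apply: openI|]; apply: closed_openC; exact: closed_point.
- by [].
have Sp : S p by split => // pb; apply: bp.
have clS : closure S b.
  apply: contrapT => nclS.
  have cS : closed S.
    move=> y cly; split; last by move=> yb; apply: nclS; rewrite -yb.
    by rewrite [E](closure_id _).1//; apply: closureS cly => z [].
  by apply: nEq; have [] : S q by rewrite (connected_clopen_setT conn oS cS)//; exists p.
have [w [Sw Ow]] := clS _ (open_nbhs_nbhs (conj oO Ob)).
pose W := connected_component (O `&` S) w.
have WOS : W `<=` O `&` S := @connected_component_sub _ _ _.
have Ww : W w by exact: connected_component_refl.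
have oW : open W by apply: open_component => //; exact: openI.
have conW : connected W by exact: component_connected.
(* Otherwise [W] would be relatively clopen in the connected set [O], which contains [b]. *)
have clW : closure W b.
  apply: contrapT => nclW.
  apply: (@connected_not_split _ O W (~` closure W) w b) => //.
  - exact/closed_openC/closed_closure.
  - move=> y Oy; have [cly|] := pselect (closure W y); last by right.
    left; apply: component_closed_in => //; split => //; split.
      by rewrite [E](closure_id _).1//; apply: closureS cly => z /WOS[_ []].
    by move=> yb; apply: nclW; rewrite -yb.
  - by rewrite -subset0 => y [/subset_closure].
have clWO : closure W `<=` closure O by apply: closureS => y /WOS[].
have nclWp : ~ closure W p by move=> /clWO/clO[[+ _] _]; apply.
have nclWx : ~ closure W x by move=> /clWO/clO[[_ +] _]; apply.
have nclWq : ~ closure W q by move=> /clWO/clO[_]; apply.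
pose F := [set K | subcontinuum K /\ K `<=` W].
have F0 : F !=set0.
  by exists [set w]; split; [exact: subcontinuum1|move=> _ ->].
have dF : up_directed F by exact: up_directed_subcontinua.
have WF : \bigcup_(K in F) K = W by apply: bigcup_subcontinua => //; exists w.
have sepF z : E z -> z <> b -> ~ closure W z -> exists2 K, F K & ~ joined K q z.
  move=> Ez zb nclz; apply: contrapT => H.
  have : joined (closure W) q z.
    rewrite -WF; apply: joined_closure_bigcup; rewrite ?WF//.
    + by move=> K [].
    + by move=> K FK; apply: contrapT => nK; apply: H; exists K.
  move=> [C [Cq CW cC Cz]].
  apply: (@connected_not_split _ C S (~` E) z q) => //.
  - exact: closed_openC.
  - move=> y Cy; have [Ey|] := pselect (E y); last by right.
    by left; split => // yb; apply: (CW _ Cy); rewrite yb.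
  - by rewrite -subset0 => y [[]].
have [K FK Kp] : exists2 K, F K & ~ joined K q p.
  by apply: sepF => // pb; apply: bp.
have [L FL Lx] : exists2 K, F K & ~ joined K q x.
  by apply: sepF => // xb; apply: bx.
have [M [sM MW] KLM] := dF _ _ FK FL.
have nM z : ~ closure W z -> ~ M z by apply: contra_not => /MW/subset_closure.
have [||k [Mk kp kx]] := @separating_point M q p x sM (nM _ nclWq) (nM _ nclWp) (nM _ nclWx).
- by apply: contra_not Kp; apply: componentS; apply: subsetC => z Kz; apply: KLM; left.
- by apply: contra_not Lx; apply: componentS; apply: subsetC => z Kz; apply: KLM; right.
by exists k; split => //; have [] := WOS _ (MW _ Mk).
Qed.

(** The closure of each component of the complement of [E] contains [b] and no other point of [E].
    Adding [b] connects all these components, one of which contains [q], while avoiding [k]. *)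
Lemma fill_closer_separating_point E b k : one_point_boundary E -> E b ->
  open (E `\ b) -> (E `\ b) k -> fill q [set k] `<=` E `\ b.
Proof.
move=> [cE Ep Ex nEq _] Eb oS [Ek kb].
have joinb y : ~ E y -> joined [set k] b y.
  move=> nEy; set C := connected_component (~` E) y.
  have Cy : C y by exact: connected_component_refl.
  have CE : C `<=` ~` E := @connected_component_sub _ _ _.
  have oC : open C by apply: open_component => //; exact: closed_openC.
  have clC z : closure C z -> z <> b -> C z.
    move=> clz zb; have [Ez|nEz] := pselect (E z); last exact: component_closed_in.
    have Sz : (E `\ b) z by split.
    by have [v [/CE nEv [Ev _]]] := clz _ (open_nbhs_nbhs (conj oS Sz)).
  have clCb : closure C b.
    apply: contrapT => nclb.
    have cC : closed C by move=> z clz; apply: clC => // zb; apply: nclb; rewrite -zb.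
    apply: (CE p) => //.
    by rewrite (connected_clopen_setT conn oC cC)//; exists y.
  exists (C `|` [set b]); last by left.
  split; [by right| |].
    by move=> z [/CE nEz zk|->]; [apply: nEz; rewrite zk|move=> bk; apply: kb].
  by apply: connected_adjoin => //; exact: component_connected.
have qb : joined [set k] q b by apply: connected_component_sym; exact: joinb.
move=> z Fz; split; last by move=> zb; apply: Fz; rewrite zb.
apply: contrapT => nEz; apply: Fz.
exact: connected_component_trans (joinb _ nEz).
Qed.

(** Filling the closer point gives an admissible set that misses [b], hence one strictly smaller
    than the minimal [E]. *)
Lemma no_three_noncut_points : False.
Proof.
have [|F FP F0 tF|E PE minE] := @minimal_set_exists X one_point_boundary (fill q [set c]).
- exact: one_point_boundary_fill.
- exact: one_point_boundary_bigcap.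
have [_ _ _ nEq [b Eb oS]] := PE.
have [k [[Ek kb] kp kx]] := closer_separating_point PE Eb oS.
have kq : k <> q by move=> kq; apply: nEq; rewrite -kq.
have sub := fill_closer_separating_point PE Eb oS (conj Ek kb).
have EE : fill q [set k] = E.
  apply: minE; first exact: one_point_boundary_fill.
  by move=> z /sub[].
by have : fill q [set k] b by [rewrite EE]; move=> /sub[_]; apply.
Qed.

End ThreeNoncutPoints.

(** Each side of a cut contains a noncut point, so there are [p] and [q] on different sides of [c],
    and they are the only noncut points. If [z] did not separate them, [fill p [set z]] would
    contain a third. *)
Lemma cut_point_irreducible (c : X) : ~ connected (~` [set c]) ->
  exists p q : X, p <> q /\ forall z, z <> p -> z <> q -> ~ joined [set z] p q.
Proof.
move=> cutc; have [a [b [ac bc nab]]] := not_connected_components cutc.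
have noncut_in z y : z <> y -> exists2 w, ~ joined [set z] y w & connected (~` [set w]).
  move=> zy; apply: (@NCstar_noncut_point (fill y [set z]) y).
    apply: NCstar_fill => //; first exact: subcontinuum1.
    by move=> yz; apply: zy.
  by apply: fill_notin => yz; apply: zy.
have [p pa noncutp] : exists2 w, ~ joined [set c] a w & connected (~` [set w]).
  by apply: noncut_in => ca; apply: ac.
have cp : c <> p by move=> cp; apply: cutc; rewrite cp.
have [q qp noncutq] := noncut_in _ _ cp.
have cq : c <> q by move=> cq; apply: cutc; rewrite cq.
have pq : p <> q.
  by move=> pq; apply: qp; rewrite -pq; apply: connected_component_refl => /esym.
have two z : connected (~` [set z]) -> z = p \/ z = q.
  move=> noncutz; apply: contrapT => /not_orP[zp zq].
  have [jqz|njqz] := pselect (joined [set c] q z).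
    apply: (@no_three_noncut_points q z p c) => //; first by move=> /esym.
    move=> jpz; apply: qp; apply: (connected_component_trans jpz).
    exact: connected_component_sym.
  apply: (@no_three_noncut_points p z q c) => //; first by move=> /esym.
  by move=> /connected_component_sym.
exists p, q; split => // z zp zq jpq.
have [w jw noncutw] := noncut_in _ _ zp.
have [wp|wq] := two _ noncutw.
- by apply: jw; rewrite wp; apply: connected_component_refl => /esym.
- by apply: jw; rewrite wq.
Qed.

End SeparatingPoints.

(** * Arc-like subsets *)

Section ArcLike.
Context {T : topologicalType}.
Implicit Types (A : set T) (p q x : T).

Definition separated_in A p q x := exists P Q,
  [/\ open P, open Q, P `&` Q = set0, A `&` (P `|` Q) = A `\ x & P p /\ Q q].

Definition locally_connected_in A := forall x O, A x -> open O -> O x ->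
  exists W, [/\ open W, W x, W `<=` O & connected (W `&` A)].

(** Stated for a subset, because it is applied to the whole space in the arc case and to two halves
    of the space in the circle case. *)
Record arc_like A p q : Prop := ArcLike {
  arc_like_neq : p <> q;
  arc_like_left : A p;
  arc_like_right : A q;
  arc_like_closed : closed A;
  arc_like_connected : connected A;
  arc_like_locally_connected : locally_connected_in A;
  arc_like_separated : forall x, A x -> x <> p -> x <> q -> separated_in A p q x }.

End ArcLike.

(** * Finding arc-like sets, first between irreducible ends and then without cut points *)

Section NoCutPoint.
Context {X : topologicalType}.
Context (hX : hausdorff_space X) (cpt : compact [set: X]).
Context (conn : connected [set: X]) (lc : @locally_connected_space X).
Context (hcl : closed_in_CX (@NCstar X)).
Implicit Types (A B C E P Q O K U V : set X) (x y p q k : X).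

Notation joined K := (connected_component (~` K)).

Lemma irreducible_arc_like p q : p <> q ->
  (forall z, z <> p -> z <> q -> ~ joined [set z] p q) -> arc_like [set: X] p q.
Proof.
move=> pq irr; split => //.
- move=> x O _ oO Ox; have [W [oW cW Wx WO]] := lc oO Ox.
  by exists W; split => //; rewrite setIT.
- move=> x _ xp xq.
  exists (joined [set x] p), (~` (joined [set x] p `|` [set x])); split.
  + by apply: open_component => //; apply: closed_openC; exact: closed_point.
  + by apply: closed_openC; exact: closed_component_point.
  + by rewrite -subset0 => y [jy]; apply; left.
  + rewrite setTI; apply/seteqP; split => y.
      by move=> [/connected_component_sub yx|nyx]; split => // yx'; apply: nyx; right.
    move=> [_ yx]; have [|jy] := pselect (joined [set x] p y); first by left.
    by right=> -[].
  + split; first by apply: connected_component_refl => /esym.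
    by move=> [|/esym//]; exact: irr.
Qed.

Section Circle.
Context (noncut : forall x, connected (~` [set x])).

(** By [separating_point], a separating continuum would contain a cut point. *)
Lemma subcontinuum_connectedC K : subcontinuum K -> connected (~` K).
Proof.
move=> sK; apply: contrapT => /not_connected_components[a [b [nKa nKb nab]]].
have [k [Kk kab _]] := separating_point hX cpt conn lc hcl sK nKa nKb nKb nab nab.
by apply: kab; apply: connected_joined => // ek; [apply: nKa|apply: nKb]; rewrite ek.
Qed.

Lemma closure_setC2 U p q : open U -> U !=set0 -> U `<=` ~` [set p; q] ->
  closure U `<=` U `|` [set p; q] -> p <> q -> closure U p.
Proof.
move=> oU [u Uu] Upq clU pq; apply: contrapT => nclp.
apply: (@connected_not_split _ (~` [set q]) U (~` closure U) u p) => //.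
- exact/closed_openC/closed_closure.
- move=> y yq; have [/clU|] := pselect (closure U y); last by right.
  by case=> [|[yp|//]]; [left|right; rewrite yp].
- by rewrite -subset0 => y [/subset_closure].
- by move=> uq; apply: (Upq _ Uu); right.
Qed.

(** For a circle, [U] and [V] are the two open arcs between [p] and [q]. *)
Definition cut_pair p q U V := [/\ open U, open V, connected U, connected V &
  [/\ U !=set0, V !=set0, U `&` V = set0, ~` [set p; q] = U `|` V &
   closure U = U `|` [set p; q] /\ closure V = V `|` [set p; q]]].

Lemma cut_pairC p q U V : cut_pair p q U V -> cut_pair p q V U.
Proof.
move=> [oU oV cU cV [U0 V0 UV0 UVpq [clU clV]]]; split => //.
by split => //; rewrite 1?(setIC V) 1?(setUC V).
Qed.

Lemma cut_pair_swap p q U V : cut_pair p q U V -> cut_pair q p U V.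
Proof. by rewrite /cut_pair (setUC [set q]). Qed.

Lemma closed_set2 p q : closed [set p; q].
Proof. by apply: closedU; exact: closed_point. Qed.

(** [U] is a component of the complement of the two points and [V] its exterior; [V] is connected
    because its complement is a continuum, which cannot separate a space without cut points. *)
Lemma cut_pair_exists p q : p <> q -> exists U V, cut_pair p q U V.
Proof.
move=> pq; have npq : ~ connected (~` [set p; q]).
  move=> /(connected_setC2_separating_point hX cpt conn lc hcl pq)[k [kp kq]].
  by apply; apply: connected_joined => // /esym.
have [a [b [apq bpq nab]]] := not_connected_components npq.
pose U := joined [set p; q] a.
have oU : open U by apply: open_component => //; apply: closed_openC; exact: closed_set2.
have Ua : U a by exact: connected_component_refl.
have conU : connected U by exact: component_connected.
have Upq : U `<=` ~` [set p; q] := @connected_component_sub _ _ _.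
have clUs : closure U `<=` U `|` [set p; q].
  move=> y cly; have [|ypq] := pselect ([set p; q] y); first by right.
  by left; exact: component_closed_in.
have clUE W : open W -> W !=set0 -> W `<=` ~` [set p; q] ->
    closure W `<=` W `|` [set p; q] -> closure W = W `|` [set p; q].
  move=> oW W0 Wpq clW; apply/seteqP; split => // y [/subset_closure//|[->|->]].
    exact: (closure_setC2 oW W0 Wpq clW).
  apply: (@closure_setC2 W q p) => //; rewrite 1?(setUC [set q])//.
  by move=> /esym.
have clU : closure U = U `|` [set p; q] by apply: clUE => //; exists a.
pose V := ~` closure U.
have oV : open V by exact/closed_openC/closed_closure.
have Vb : V b by rewrite /V clU => -[].
have Vpq : V `<=` ~` [set p; q] by rewrite /V clU => y nUy ypq; apply: nUy; right.
have UV0 : U `&` V = set0 by rewrite -subset0 => y [/subset_closure].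
have clV : closure V = V `|` [set p; q].
  apply: clUE => //; first by exists b.
  move=> y cly; have [Uy|nUy] := pselect (U y).
    have [z [Vz Uz]] := cly _ (open_nbhs_nbhs (conj oU Uy)).
    by have : (U `&` V) z by []; rewrite UV0.
  have [|ypq] := pselect ([set p; q] y); first by right.
  by left; rewrite /V clU => -[].
exists U, V; split => //.
  apply: subcontinuum_connectedC; apply: subcontinuum_closure => //.
  by exists a.
split => //; [by exists a|by exists b|].
apply/seteqP; split => y; last by move=> [/Upq|/Vpq].
move=> ypq; have [|nUy] := pselect (U y); first by left.
by right; rewrite /V clU => -[].
Qed.

(** Near [p] and away from [q], every component of [W] minus [p] that meets [U] stays in [U] and
    accumulates at [p]. Thus the trace of [W] is a union of connected sets through [p]. *)
Lemma locally_connected_in_left_end p q U V x O : p <> q -> cut_pair p q U V ->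
  x = p -> open O -> O x ->
  exists W, [/\ open W, W x, W `<=` O & connected (W `&` closure U)].
Proof.
move=> pq [oU oV conU conV [U0 V0 UV0 UVpq [clU clV]]] -> oO Op.
have [||W [oW cW Wp WO]] := @lc p (O `&` ~` [set q]).
- by apply: openI => //; apply: closed_openC; exact: closed_point.
- by [].
exists W; split => //; first by move=> y /WO[].
have clUp : closure U p by rewrite clU; right; left.
have -> : W `&` closure U = connected_component (W `&` closure U) p.
  apply/seteqP; split; last exact: connected_component_sub.
  move=> y [Wy clUy]; have [->|yp] := pselect (y = p).
    by apply: connected_component_refl.
  pose C := connected_component (W `\ p) y.
  have Cy : C y by apply: connected_component_refl; split.
  have CWp : C `<=` W `\ p := @connected_component_sub _ _ _.
  have oC : open C.
    apply: open_component => //; apply: openI => //; apply: closed_openC.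
    exact: closed_point.
  have yq : y <> q by move=> yq; have [_] := WO _ Wy; rewrite yq; apply.
  have Uy : U y by move: clUy; rewrite clU => -[//|[]].
  have CU : C `<=` U.
    apply: (connected_sub_open _ oU oV).
    - exact: component_connected.
    - rewrite -UVpq => z /CWp[Wz zp] [//|zq].
      by have [_] := WO _ Wz; rewrite zq; apply.
    - by rewrite -setIA UV0 setI0.
    - by exists y.
  have clCp : closure C p.
    apply: contrapT => nclp.
    apply: (@connected_not_split _ W C (~` closure C) y p) => //.
    - exact/closed_openC/closed_closure.
    - move=> z Wz; have [clz|] := pselect (closure C z); last by right.
      left; apply: component_closed_in => //; split => // zp.
      by apply: nclp; rewrite -zp.
    - by rewrite -subset0 => z [/subset_closure].
  exists (C `|` [set p]); last by left.
  split; [by right| |].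
    move=> z [Cz|->]; last by [].
    by split; [have [] := CWp _ Cz|apply: subset_closure; exact: CU].
  by apply: connected_adjoin => //; exact: component_connected.
exact: component_connected.
Qed.

Lemma cut_pair_locally_connected p q U V : p <> q -> cut_pair p q U V ->
  locally_connected_in (closure U).
Proof.
move=> pq Upq x O clUx oO Ox.
have [oU oV conU conV [U0 V0 UV0 UVpq [clU clV]]] := Upq.
move: (clUx); rewrite {1}clU => -[Ux|[xp|xq]].
- have [||W [oW cW Wx WO]] := @lc x (O `&` U); [exact: openI|by []|].
  exists W; split => //; first by move=> y /WO[].
  suff -> : W `&` closure U = W by [].
  by apply/setIidPl => y /WO[_ /subset_closure].
- exact: (locally_connected_in_left_end pq Upq xp).
- apply: (@locally_connected_in_left_end q p U V) => //.
    by move=> /esym.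
  exact: cut_pair_swap.
Qed.

(** Cut the space at [x] and at a point [v] of [V]. If one side [H] contained neither [p] nor [q],
    its closure would connect [x] to [v] within the disjoint open sets [U] and [V]; so the two sides
    part [p] from [q]. *)
Lemma cut_pair_separated p q U V x : p <> q -> cut_pair p q U V -> U x ->
  separated_in (closure U) p q x.
Proof.
move=> pq [oU oV conU conV [U0 [v Vv] UV0 UVpq [clU clV]]] Ux.
have xv : x <> v.
  move=> xv; have : (U `&` V) x by split => //; rewrite xv.
  by rewrite UV0.
have npq z : (U `|` V) z -> z <> p /\ z <> q.
  by rewrite -UVpq => npq; split => zE; apply: npq; [left|right].
have [xp xq] : x <> p /\ x <> q by apply: npq; left.
have [vp vq] : v <> p /\ v <> q by apply: npq; right.
have key G H : cut_pair x v G H -> G p -> separated_in (closure U) p q x.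
  move=> [oG oH conG conH [G0 H0 GH0 GHxv [clG clH]]] Gp.
  have Hq : H q.
    have : (G `|` H) q by rewrite -GHxv => -[|] /esym.
    case=> // Gq; exfalso.
    apply: (@connected_not_split _ (closure H) U V x v) => //.
    - exact: connected_closure.
    - rewrite -UVpq clH => z.
      move=> [Hz|[->|->]].
      + have : ~ (G `&` H) z by rewrite GH0.
        by move=> nGHz [zE|zE]; apply: nGHz; split => //; rewrite zE.
      + by move=> [].
      + by move=> [].
    - by rewrite clH; right; left.
    - by rewrite clH; right; right.
  exists G, H; split => //; rewrite -GHxv.
  apply/seteqP; split => z [clz nz]; split => //.
    by move=> zx; apply: nz; left.
  move=> [//|zv]; have Vz : V z by rewrite zv.
  have [w [Uw Vw]] := clz _ (open_nbhs_nbhs (conj oV Vz)).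
  by have : (U `&` V) w by []; rewrite UV0.
have [G [H GH]] := cut_pair_exists xv.
have : (G `|` H) p.
  by have [_ _ _ _ [_ _ _ <- _]] := GH => -[|] /esym.
by move=> [|]; [exact: (key G H)|apply: (key H G); exact: cut_pairC].
Qed.

Lemma cut_pair_arc_like p q U V : p <> q -> cut_pair p q U V ->
  arc_like (closure U) p q.
Proof.
move=> pq Upq; have [oU oV conU conV [U0 V0 UV0 UVpq [clU clV]]] := Upq.
split => //.
- by rewrite clU; right; left.
- by rewrite clU; right; right.
- exact: closed_closure.
- exact: connected_closure.
- exact: cut_pair_locally_connected Upq.
- move=> x clUx xp xq; apply: (cut_pair_separated pq Upq).
  by move: clUx; rewrite clU => -[//|[]].
Qed.

End Circle.
End NoCutPoint.

(** * Initial and final segments of an arc-like set *)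

Section Segments.
Context {T : topologicalType} (hT : hausdorff_space T).
Implicit Types (A C D : set T) (p q x y z : T).

(** In an arc from [p] to [q], these are the closed subarcs on either side of [x]. *)
Record segment_at A p q x D E : Prop := SegmentAt {
  segment_init_closed : closed D;
  segment_fin_closed : closed E;
  segment_cover : A = D `|` E;
  segment_meet : D `&` E = [set x];
  segment_init_left : D p;
  segment_fin_right : E q;
  segment_init_connected : connected D;
  segment_fin_connected : connected E }.

(** A closed piece of [D] that misses [x] also misses [E], so it would split off from [A]. *)
Lemma connected_segment A D E x : connected A -> closed D -> closed E ->
  A = D `|` E -> D `&` E = [set x] -> connected D.
Proof.
move=> cA cD cE ADE DEx; apply: closed_connectedP => // P Q cP cQ DPQ PQ0 P0 Q0.
have [Dx Ex] : (D `&` E) x by rewrite DEx.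
wlog Px : P Q cP cQ DPQ PQ0 P0 Q0 / P x.
  move=> wl; move: (Dx); rewrite DPQ => -[Px|Qx]; first exact: (wl P Q).
  by apply: (wl Q P) => //; rewrite 1?(setUC Q) 1?(setIC Q).
have disj z : P z -> Q z -> False.
  by move=> Pz Qz; have : (P `&` Q) z by []; rewrite PQ0.
have DEz z : D z -> E z -> z = x.
  by move=> Dz Ez; have : (D `&` E) z by []; rewrite DEx.
have QD z : Q z -> D z by rewrite DPQ; right.
have [y Qy] := Q0.
have : (P `|` E) y.
  have Ay : A y by rewrite ADE; left; exact: QD.
  apply: (@connected_sub_closed _ A (P `|` E) Q) => //.
  - exact: closedU.
  - by rewrite ADE DPQ => z [[|]|]; [left; left|right|left; right].
  - rewrite -subset0 => z [[_ [Pz|Ez]] Qz]; first exact: (disj z).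
    by apply: (disj z) => //; rewrite (DEz z (QD z Qz) Ez).
  - by exists x; split; [rewrite ADE; left|left].
move=> [Py|Ey]; first exact: (disj y).
by apply: (disj y) => //; rewrite (DEz y (QD y Qy) Ey).
Qed.

Lemma arc_like_segment A p q x : arc_like A p q -> A x ->
  exists D E, segment_at A p q x D E.
Proof.
move=> [pq Ap Aq cA conA _ sepA] Ax.
(* At either end one segment degenerates to a point, as [arc_like] gives a separation only at other
   points. *)
have [->|xp] := pselect (x = p).
  exists [set p], A; split => //; first exact: closed_point.
  - by apply/seteqP; split => y; [right|move=> [->|]].
  - by apply/setIidPl => _ ->.
  - exact: connected1.
have [->|xq] := pselect (x = q).
  exists A, [set q]; split => //; first exact: closed_point.
  - by apply/seteqP; split => y; [left|move=> [|->]].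
  - by apply/setIidPr => _ ->.
  - exact: connected1.
have [P [Q [oP oQ PQ0 APQ [Pp Qq]]]] := sepA _ Ax xp xq.
have disj z : P z -> Q z -> False.
  by move=> Pz Qz; have : (P `&` Q) z by []; rewrite PQ0.
have nPQx : ~ (P `|` Q) x.
  move=> PQx; have : (A `\ x) x by rewrite -APQ.
  by move=> [_]; apply.
have cD : closed (A `&` ~` Q) by apply: closedI => //; exact: open_closedC.
have cE : closed (A `&` ~` P) by apply: closedI => //; exact: open_closedC.
have ADE : A = A `&` ~` Q `|` A `&` ~` P.
  apply/seteqP; split => y; last by case => -[].
  move=> Ay; have [Py|] := pselect (P y); last by right.
  by left; split => // Qy; exact: (disj y).
have DEx : (A `&` ~` Q) `&` (A `&` ~` P) = [set x].
  apply/seteqP; split => y; last first.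
    by move=> ->; split; split => // ?; apply: nPQx; [right|left].
  move=> [[Ay nQy] [_ nPy]]; apply: contrapT => yx.
  have : (A `&` (P `|` Q)) y by rewrite APQ.
  by move=> [_ []].
exists (A `&` ~` Q), (A `&` ~` P); split => //.
- by split => // Qp; exact: (disj p).
- by split => // Pq; exact: (disj q).
- exact: (connected_segment conA cD cE ADE DEx).
- by apply: (connected_segment conA cE cD (x := x)); [rewrite setUC|rewrite setIC].
Qed.

(** * The separation order, in which [D y z] reads as [z] not after [y] *)

Section Order.
Context (A : set T) (p q : T) (D E : T -> set T).
Context (segs : forall x, A x -> segment_at A p q x (D x) (E x)).

Lemma segment_self x : A x -> D x x /\ E x x.
Proof. by move=> Ax; have [_ _ _ DEx _ _ _ _] := segs Ax; have : (D x `&` E x) x by rewrite DEx. Qed.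

Lemma segment_eq x z : A x -> D x z -> E x z -> z = x.
Proof.
by move=> Ax Dz Ez; have [_ _ _ DEx _ _ _ _] := segs Ax;
  have : (D x `&` E x) z by []; rewrite DEx.
Qed.

Lemma segment_sub x : A x -> D x `<=` A.
Proof. by move=> Ax; have [_ _ -> _ _ _ _ _] := segs Ax => z; left. Qed.

Lemma segment_sub_fin x : A x -> E x `<=` A.
Proof. by move=> Ax; have [_ _ -> _ _ _ _ _] := segs Ax => z; right. Qed.

Lemma segment_total x z : A x -> A z -> D x z \/ E x z.
Proof. by move=> Ax; have [_ _ -> _ _ _ _ _] := segs Ax. Qed.

Lemma connected_sub_init C y u : A y -> connected C -> C `<=` A -> ~ C y ->
  C u -> D y u -> C `<=` D y.
Proof.
move=> Ay cC CA nCy Cu Du; have [cD cE ADE DEy _ _ _ _] := segs Ay.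
apply: (connected_sub_closed cC cD cE); first by rewrite -ADE.
  by rewrite -setIA DEy -subset0 => z [Cz zy]; apply: nCy; rewrite -zy.
by exists u.
Qed.

Lemma connected_sub_fin C y u : A y -> connected C -> C `<=` A -> ~ C y ->
  C u -> E y u -> C `<=` E y.
Proof.
move=> Ay cC CA nCy Cu Eu; have [cD cE ADE DEy _ _ _ _] := segs Ay.
apply: (connected_sub_closed cC cE cD); first by rewrite setUC -ADE.
  by rewrite -setIA (setIC (E y)) DEy -subset0 => z [Cz zy]; apply: nCy; rewrite -zy.
by exists u.
Qed.

(** [E x] is connected, contains [q] and misses [y] unless [y] is [x], so it stays on the side of
    [q] at [y]. *)
Lemma segment_fin_mono x y : A x -> D x y -> E x `<=` E y.
Proof.
move=> Ax Dxy; have Ay := segment_sub Ax Dxy.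
have [->//|yx] := pselect (y = x).
have [_ _ _ _ _ Exq _ conE] := segs Ax; have [_ _ _ _ _ Eyq _ _] := segs Ay.
apply: (connected_sub_fin Ay conE (segment_sub_fin Ax) _ Exq Eyq).
by move=> Exy; apply: yx; exact: segment_eq.
Qed.

Lemma segment_init_mono x y : A x -> E x y -> D x `<=` D y.
Proof.
move=> Ax Exy; have Ay := segment_sub_fin Ax Exy.
have [->//|yx] := pselect (y = x).
have [_ _ _ _ Dxp _ conD _] := segs Ax; have [_ _ _ _ Dyp _ _ _] := segs Ay.
apply: (connected_sub_init Ay conD (segment_sub Ax) _ Dxp Dyp).
by move=> Dxy; apply: yx; exact: segment_eq.
Qed.

Lemma segment_trans x y : A x -> D x y -> D y `<=` D x.
Proof.
move=> Ax Dxy z Dyz; have Ay := segment_sub Ax Dxy.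
have [//|Exz] := segment_total Ax (segment_sub Ay Dyz).
have Eyz := segment_fin_mono Ax Dxy Exz.
by rewrite (segment_eq Ay Dyz Eyz).
Qed.

Lemma segment_anti x y : A x -> A y -> D x y -> D y x -> x = y.
Proof.
move=> Ax Ay Dxy Dyx; apply: segment_eq => //.
by apply: (segment_fin_mono Ax Dxy); have [] := segment_self Ax.
Qed.

(** If [C] missed [z], it would stay on the side of [z] that contains [x]; then [y] would not come
    after [z] and would equal it by antisymmetry. *)
Lemma connected_convex C x y z : connected C -> C `<=` A -> C x -> C y ->
  D y z -> ~ D x z -> C z.
Proof.
move=> cC CA Cx Cy Dyz nDxz; apply: contrapT => nCz.
have [Ax Ay] := (CA _ Cx, CA _ Cy); have Az := segment_sub Ay Dyz.
have [//|Exz] := segment_total Ax Az.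
have Dzx : D z x by apply: (segment_init_mono Ax Exz); have [] := segment_self Ax.
have Dzy := connected_sub_init Az cC CA nCz Cx Dzx Cy.
by apply: nCz; rewrite (segment_anti Az Ay).
Qed.

Lemma segment_min x : A x -> D x p.
Proof. by move=> Ax; have [] := segs Ax. Qed.

Lemma segment_max x : A x -> A q -> D q x.
Proof.
move=> Ax Aq; have [_ _ _ _ _ Exq _ _] := segs Ax.
by apply: (segment_init_mono Ax Exq); have [] := segment_self Ax.
Qed.

End Order.
End Segments.

(** * Truncated distance functions and finite nets *)

Section Proximity.
Context {R : realType} {X : pseudoMetricType R}.
Implicit Types (c x y z : X) (e : R).

(* [1 - min (1, dist (c, z))] *)
Definition proximity c z : R :=
  sup [set r | r = 0 \/ exists e, [/\ 0 < e, ball c e z & r = 1 - e]].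

Let has_sup_proximity c z :
  has_ubound [set r : R | r = 0 \/ exists e, [/\ 0 < e, ball c e z & r = 1 - e]].
Proof. by exists 1 => r [->//|[e [e0 _ ->]]]; lra. Qed.

Lemma proximity_ge0 c z : 0 <= proximity c z.
Proof. by apply: ub_le_sup => //; left. Qed.

Lemma proximity_ge c z e : 0 < e -> ball c e z -> 1 - e <= proximity c z.
Proof. by move=> e0 cez; apply: ub_le_sup => //; right; exists e. Qed.

Lemma proximity_le c z (m : R) : 0 <= m ->
  (forall e, 0 < e -> ball c e z -> 1 - e <= m) -> proximity c z <= m.
Proof.
move=> m0 H; apply: ge_sup; first by exists 0; left.
by move=> r [->//|[e [e0 cez ->]]]; exact: H.
Qed.

Lemma proximity_le1 c z : proximity c z <= 1.
Proof. by apply: proximity_le => // e e0 _; lra. Qed.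

Lemma proximity_lipschitz c z y e : 0 < e -> ball z e y ->
  proximity c z <= proximity c y + e.
Proof.
move=> e0 zey; apply: proximity_le.
  by apply: addr_ge0; [exact: proximity_ge0|exact: ltW].
move=> d d0 cdz; have := @proximity_ge c y (d + e) _ (ball_triangle cdz zey).
by move=> /(_ (addr_gt0 d0 e0)); lra.
Qed.

Lemma proximity_le_far c z e : 0 < e -> e <= 1 -> ~ ball c e z ->
  proximity c z <= 1 - e.
Proof.
move=> e0 e1 ncz; apply: proximity_le; first by lra.
move=> d d0 cdz; rewrite lerD2l lerN2 leNgt; apply/negP => de.
by apply: ncz; apply: le_ball cdz; exact: ltW.
Qed.

(** The complements of finite unions of balls form a directed family with empty intersection.
    Interiors are taken because a [ball] is not assumed open. *)
Lemma compact_finite_net : compact [set: X] -> forall e, 0 < e ->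
  exists s : seq X, forall x, exists2 c, c \in s & ball c e x.
Proof.
move=> cpt e e0.
pose N (s : seq X) := [set x | exists2 c, c \in s & (ball c e)° x].
have [|||||A [s _ <-] As] := @compact_down_directed X cpt [set ~` N s | s in setT] set0.
- by exists (~` N [::]); exists [::].
- move=> _ _ [s _ <-] [t _ <-]; exists (~` N (s ++ t)); first by exists (s ++ t).
  move=> x nx; split => -[c cs cx]; apply: nx;
    by exists c => //; rewrite mem_cat cs ?orbT.
- move=> _ [s _ <-]; apply: open_closedC; rewrite openE => x [c cs cx].
  have := @open_interior _ (ball c e); rewrite openE => /(_ _ cx).
  by apply: filterS => y cy; exists c.
- exact: open0.
- move=> x /(_ (~` N [:: x])); apply; first by exists [:: x].
  by exists x; [rewrite inE|exact: nbhsx_ballx].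
exists s => x; apply: contrapT => H; apply: (As x) => -[c cs cx].
by apply: H; exists c => //; exact: interior_subset cx.
Qed.

End Proximity.

(** * Sums dominated by a geometric series *)

Section GeometricSum.
Context {R : realType} {X : Type}.

Lemma geometric_sup_exists (t : nat -> X -> R) :
  (forall n x, 0 <= t n x <= 1 / 2 ^+ n.+1) ->
  exists h : X -> R, forall N x,
    \sum_(n < N) t n x <= h x <= \sum_(n < N) t n x + 1 / 2 ^+ N.
Proof.
move=> tP; pose S N x := \sum_(n < N) t n x.
have Smono N k x : S N x <= S (N + k)%N x.
  elim: k => [|k IH]; first by rewrite addn0.
  rewrite addnS /S big_ord_recr/=; apply: (le_trans IH).
  by rewrite lerDl; have /andP[] := tP (N + k)%N x.
(* The subtracted power lets the induction on [k] close, each power being twice the next. *)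
have Sbound N k x : S (N + k)%N x <= S N x + 1 / 2 ^+ N - 1 / 2 ^+ (N + k).
  elim: k => [|k IH]; first by rewrite addn0; lra.
  rewrite addnS {1}/S big_ord_recr/= -/(S _ _).
  have /andP[_] := tP (N + k)%N x; move: IH.
  have -> : 1 / 2 ^+ (N + k) = 1 / 2 ^+ (N + k).+1 + 1 / 2 ^+ (N + k).+1 :> R.
    by rewrite exprS; field; rewrite expf_neq0.
  by lra.
have Sle N m x : S m x <= S N x + 1 / 2 ^+ N.
  have pos k : 0 <= 1 / 2 ^+ k :> R by rewrite divr_ge0// exprn_ge0.
  have [mN|Nm] := leqP m N.
    apply: (@le_trans _ _ (S N x)); last by rewrite lerDl.
    by rewrite -(subnKC mN).
  rewrite -(subnKC (ltnW Nm)); apply: (le_trans (Sbound _ _ _)).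
  by rewrite lerBlDr lerDl.
exists (fun x => sup (range (S^~ x))) => N x; apply/andP; split.
  apply: ub_le_sup; last by exists N.
  by exists (S 0%N x + 1 / 2 ^+ 0) => _ [m _ <-].
apply: ge_sup; first by exists (S 0%N x); exists 0%N.
by move=> _ [m _ <-]; exact: Sle.
Qed.

End GeometricSum.

(** * A strictly increasing continuous function on an arc-like set *)

Section Parametrization.
Context {R : realType} {X : pseudoMetricType R}.
Context (cpt : compact [set: X]).
Context (A : set X) (p q : X) (Apq : arc_like A p q).
Context (D E : X -> set X).
Context (segs : forall x, A x -> segment_at A p q x (D x) (E x)).
Implicit Types (c x y z : X) (e : R).

Definition running_sup c x : R := sup [set proximity c z | z in D x].

Lemma running_sup_ge c x z : D x z -> proximity c z <= running_sup c x.
Proof.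
move=> Dz; apply: ub_le_sup; last by exists z.
by exists 1 => _ [w _ <-]; exact: proximity_le1.
Qed.

Lemma running_sup_le c x (m : R) : A x ->
  (forall z, D x z -> proximity c z <= m) -> running_sup c x <= m.
Proof.
move=> Ax H; apply: ge_sup; last by move=> _ [z Dz <-]; exact: H.
by exists (proximity c x); exists x => //; have [] := segment_self segs Ax.
Qed.

Lemma running_sup_ge0 c x : A x -> 0 <= running_sup c x.
Proof.
move=> Ax; apply: (le_trans (proximity_ge0 c x)); apply: running_sup_ge.
by have [] := segment_self segs Ax.
Qed.

Lemma running_sup_le1 c x : A x -> running_sup c x <= 1.
Proof. by move=> Ax; apply: running_sup_le => // z _; exact: proximity_le1. Qed.

Lemma running_sup_mono c x y : A x -> A y -> D y x -> running_sup c x <= running_sup c y.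
Proof.
move=> Ax Ay Dyx; apply: running_sup_le => // z Dz; apply: running_sup_ge.
exact: (segment_trans segs Ay Dyx).
Qed.

(* Connected subsets of [A] are order-convex, so on a small connected neighborhood
   the two suprema range over sets differing only inside that neighborhood. *)
Lemma running_sup_cvg c x : A x ->
  running_sup c y @[y --> within A (nbhs x)] --> running_sup c x.
Proof.
move=> Ax; apply/cvgrPdist_le => e e0.
have e20 : 0 < e / 2 by rewrite divr_gt0.
have [||W [oW Wx WB conW]] := arc_like_locally_connected Apq Ax (O := (ball x (e / 2))°).
- exact: open_interior.
- exact: nbhsx_ballx.
have key u v : (W `&` A) u -> (W `&` A) v -> running_sup c v <= running_sup c u + e.
  move=> [Wu Au] [Wv Av]; apply: running_sup_le => // z Dz.
  have [Duz|nDuz] := pselect (D u z).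
    by apply: (le_trans (running_sup_ge c Duz)); rewrite lerDl ltW.
  have [Wz _] : (W `&` A) z.
    by apply: (connected_convex segs conW _ _ _ Dz nDuz) => // ? [].
  have zu : ball z e u.
    rewrite (splitr e); apply: (@ball_triangle _ _ x).
      by apply: ball_sym; exact: (interior_subset (WB _ Wz)).
    exact: (interior_subset (WB _ Wu)).
  apply: (le_trans (proximity_lipschitz c e0 zu)); rewrite lerD2r.
  by apply: running_sup_ge; have [] := segment_self segs Au.
apply: (@filterS _ (nbhs x) _ W); last exact: (open_nbhs_nbhs (conj oW Wx)).
move=> y Wy Ay.
have := key x y (conj Wx Ax) (conj Wy Ay); have := key y x (conj Wy Ay) (conj Wx Ax).
by rewrite ler_norml => ? ?; apply/andP; split; lra.
Qed.

(** A ball about [y] misses the closed segment [D x]. For [c] within a third of its radius, points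
    of [D x] are at least two thirds away from [c], and [y] itself at most one third. *)
Lemma running_sup_strict x y : A x -> A y -> D y x -> x <> y ->
  exists2 e, 0 < e & forall c, ball c e y -> running_sup c x < running_sup c y.
Proof.
move=> Ax Ay Dyx xy.
have nDxy : ~ D x y by move=> Dxy; apply: xy; exact: (segment_anti segs).
have cD : closed (D x) by have [] := segs Ax.
have /nbhs_ballP[d d0 yd] : nbhs y (~` D x).
  by apply: open_nbhs_nbhs; split => //; exact: closed_openC.
(* [proximity] vanishes beyond distance 1, so the radius is capped there. *)
pose e := Num.min d 1.
have e0 : 0 < e by rewrite lt_min d0 /=.
have e1 : e <= 1 by rewrite ge_min lexx orbT.
have ye : ball y e `<=` ~` D x.
  by apply: subset_trans yd; apply: le_ball; rewrite ge_min lexx.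
exists (e / 3); first by rewrite divr_gt0.
move=> c cy; apply: (@le_lt_trans _ _ (1 - e *+ 2 / 3)).
  apply: running_sup_le => // z Dz; apply: proximity_le_far.
  - by rewrite divr_gt0// mulrn_wgt0.
  - by lra.
  - move=> cz; apply: (ye z) => //.
    have -> : e = e / 3 + e *+ 2 / 3 by lra.
    by apply: ball_triangle cz; exact: ball_sym.
apply: (@lt_le_trans _ _ (1 - e / 3)); first by lra.
apply: (@le_trans _ _ (proximity c y)).
  by apply: proximity_ge => //; rewrite divr_gt0.
by apply: running_sup_ge; have [] := segment_self segs Ay.
Qed.

Definition net_sum (s : seq X) x := \sum_(c <- s) running_sup c x.

Lemma net_sum_ge0 s x : A x -> 0 <= net_sum s x.
Proof. by move=> Ax; apply: sumr_ge0 => c _; exact: running_sup_ge0. Qed.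

Lemma net_sum_le s x : A x -> net_sum s x <= (size s).+1%:R.
Proof.
move=> Ax; apply: (@le_trans _ _ (size s)%:R); last by rewrite ler_nat.
rewrite /net_sum; elim: s => [|c s IH]; first by rewrite big_nil.
rewrite big_cons /= -natr1 addrC.
by apply: lerD IH _; exact: running_sup_le1.
Qed.

Lemma net_sum_mono s x y : A x -> A y -> D y x -> net_sum s x <= net_sum s y.
Proof. by move=> Ax Ay Dyx; apply: ler_sum => c _; exact: running_sup_mono. Qed.

Lemma net_sum_lt s x y c : A x -> A y -> D y x -> c \in s ->
  running_sup c x < running_sup c y -> net_sum s x < net_sum s y.
Proof.
move=> Ax Ay Dyx cs lt_c; rewrite /net_sum !(big_rem c cs)/=.
by apply: ltr_leD => //; exact: net_sum_mono.
Qed.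

Lemma net_sum_cvg s x : A x -> net_sum s y @[y --> within A (nbhs x)] --> net_sum s x.
Proof.
move=> Ax; rewrite /net_sum; elim: s => [|c s IH].
  rewrite big_nil; under eq_fun do rewrite big_nil.
  exact: cvg_cst.
rewrite big_cons; under eq_fun do rewrite big_cons.
by apply: cvgD => //; exact: running_sup_cvg.
Qed.

Lemma arc_parametrization_segs : exists h : X -> R,
  (forall x, A x -> h y @[y --> within A (nbhs x)] --> h x) /\
  (forall x y, A x -> A y -> D y x -> x <> y -> h x < h y).
Proof.
have [net netP] : {net : nat -> seq X & forall n x,
    exists2 c, c \in net n & ball c (n.+1%:R^-1 : R) x}.
  apply: (@choice _ _ (fun n s => forall x,
    exists2 c, c \in s & ball c (n.+1%:R^-1 : R) x)) => n.
  by apply: compact_finite_net => //; rewrite invr_gt0.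
(* The weight keeps term [n] within its share of the geometric series; the successor keeps the
   denominator positive. *)
pose w n : R := 1 / 2 ^+ n.+1 / (size (net n)).+1%:R.
have w0 n : 0 < w n by rewrite !divr_gt0// exprn_gt0.
(* Outside [A] the value 0 is a default, so that the bounds of [tP] hold on all of [X]. *)
pose t n x := if pselect (A x) then w n * net_sum (net n) x else 0.
have tE n x : A x -> t n x = w n * net_sum (net n) x.
  by move=> Ax; rewrite /t; case: pselect.
have tP n x : 0 <= t n x <= 1 / 2 ^+ n.+1.
  rewrite /t; case: pselect => Ax; last by rewrite lexx/= divr_ge0// exprn_ge0.
  apply/andP; split; first by apply: mulr_ge0; [exact: ltW|exact: net_sum_ge0].
  rewrite /w -[_ * net_sum _ _]mulrA; apply: ler_piMr.
    by rewrite divr_ge0// exprn_ge0.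
  by rewrite mulrC ler_pdivrMr// mul1r net_sum_le.
have [h hP] := geometric_sup_exists tP.
exists h; split.
  move=> x Ax; apply/cvgrPdist_le => e e0.
  have e30 : 0 < e / 3 by rewrite divr_gt0.
  have [N _ /(_ N (leqnn N)) Ne] := near_infty_natSinv_expn_lt (PosNum e30).
  have : \sum_(n < N) t n y @[y --> within A (nbhs x)] --> \sum_(n < N) t n x.
    elim: N {Ne} => [|N IH].
      rewrite big_ord0; under eq_fun do rewrite big_ord0.
      exact: cvg_cst.
    rewrite big_ord_recr/=; under eq_fun do rewrite big_ord_recr/=.
    apply: cvgD => //; rewrite tE//.
    have : w N * net_sum (net N) y @[y --> within A (nbhs x)] --> w N * net_sum (net N) x.
      by apply: cvgM; [exact: cvg_cst|exact: net_sum_cvg].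
    apply: cvg_trans; apply: near_eq_cvg.
    by apply: (@filterE _ (nbhs x)) => y Ay; rewrite tE.
  move=> /cvgrPdist_le/(_ _ e30); apply: (@filterS _ (nbhs x)) => y SN Ay.
  have {SN} := SN Ay; have := hP N x; have := hP N y; move: Ne => /=.
  by rewrite !ler_norml => ? /andP[? ?] /andP[? ?] /andP[? ?]; apply/andP; split; lra.
move=> x y Ax Ay Dyx xy.
have [e e0 eP] := running_sup_strict Ax Ay Dyx xy.
have [n _ /(_ n (leqnn n)) /= ne] := near_infty_natSinv_lt (PosNum e0).
have [c cn cy] := netP n y.
have lt_c := eP c (le_ball (ltW ne) cy).
have tmono m : t m x <= t m y.
  by rewrite !tE// ler_pM2l// net_sum_mono.
pose d := t n y - t n x.
have d0 : 0 < d by rewrite subr_gt0 !tE// ltr_pM2l//; exact: net_sum_lt lt_c.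
have [M _ MP] := near_infty_natSinv_expn_lt (PosNum d0).
(* [N] is past [n], so that the gain [d] counts, and so large that the tail cannot cancel it. *)
pose N := maxn M n.+1.
have /= Nd := MP N (leq_maxl _ _).
have nN : (n < N)%N by exact: leq_maxr.
have : \sum_(i < N) t i x + d <= \sum_(i < N) t i y.
  rewrite (bigD1 (Ordinal nN))//= [leRHS](bigD1 (Ordinal nN))//= /d.
  have : \sum_(i < N | i != Ordinal nN) t i x <= \sum_(i < N | i != Ordinal nN) t i y.
    by apply: ler_sum.
  by lra.
by have /andP[_ ?] := hP N x; have /andP[? _] := hP N y; lra.
Qed.

End Parametrization.

(** * Bijections of arc-like sets onto the unit interval, and continuity of inverses *)

Section ArcParametrization.
Context {R : realType} {X : pseudoMetricType R}.
Context (hX : hausdorff_space X) (cpt : compact [set: X]).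

Lemma arc_parametrization (A : set X) (p q : X) : arc_like A p q ->
  exists h : X -> R, [/\ {within A, continuous h}, h p = 0, h q = 1,
    (forall x y, A x -> A y -> h x = h y -> x = y) &
    [set h x | x in A] = `[0, 1]%classic].
Proof.
move=> Apq; have [pq Ap Aq cA conA _ _] := Apq.
have [DE DEP] : {DE : X -> set X * set X & forall x, A x ->
    segment_at A p q x (DE x).1 (DE x).2}.
  apply: (@choice _ _ (fun x DE => A x -> segment_at A p q x DE.1 DE.2)) => x.
  have [Ax|nAx] := pselect (A x); last by exists (set0, set0).
  by have [D [E DE]] := arc_like_segment hX Apq Ax; exists (D, E).
pose D x := (DE x).1; pose E x := (DE x).2.
have segs x : A x -> segment_at A p q x (D x) (E x) by exact: DEP.
have [h [hcvg hlt]] := arc_parametrization_segs cpt Apq segs.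
have hpq : h p < h q by apply: hlt => //; exact: (segment_min segs).
have hge x : A x -> h p <= h x.
  move=> Ax; have [->//|px] := pselect (p = x).
  by apply/ltW/hlt => //; exact: (segment_min segs).
have hle x : A x -> h x <= h q.
  move=> Ax; have [->//|xq] := pselect (x = q).
  by apply/ltW/hlt => //; exact: (segment_max segs).
have d0 : 0 < h q - h p by rewrite subr_gt0.
pose g x := (h x - h p) / (h q - h p).
have gp : g p = 0 by rewrite /g subrr mul0r.
have gq : g q = 1 by rewrite /g divff// gt_eqF.
have gcont : {within A, continuous g}.
  apply/subspace_continuousP => x Ax; apply: cvgM; last exact: cvg_cst.
  by apply: cvgB; [exact: hcvg|exact: cvg_cst].
exists g; split => //.
- move=> x y Ax Ay /(divIf (lt0r_neq0 d0))/addIr hxy; apply: contrapT => xy.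
  have [Dxy|Exy] := segment_total segs Ax Ay.
    have : h y < h x by apply: hlt => // /esym.
    by rewrite hxy ltxx.
  have Dyx : D y x by apply: (segment_init_mono segs Ax Exy); have [] := segment_self segs Ax.
  by have := hlt _ _ Ax Ay Dyx xy; rewrite hxy ltxx.
- have conG : is_interval [set g x | x in A].
    by apply/connected_intervalP; exact: connected_continuous_connected.
  apply/seteqP; split => [_ [x Ax <-]|r].
    rewrite /= in_itv/= /g divr_ge0 ?subr_ge0 ?hge// ?(ltW hpq)//=.
    by rewrite ler_pdivrMr// mul1r lerD2r hle.
  rewrite /= in_itv/= => r01; apply: (conG 0 1) => //.
    by exists p.
  by exists q.
Qed.

End ArcParametrization.

(** A continuous map from a compact space to a Hausdorff space is closed, so its inverse is
    continuous on the image. *)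
Lemma compact_inverse_continuous (T U : topologicalType) (g : T -> U) (f : U -> T) :
  compact [set: T] -> hausdorff_space U -> continuous g ->
  (forall x, f (g x) = x) -> {within range g, continuous f}.
Proof.
move=> cT hU cg fg; apply/subspace_continuousP => _ [x _ <-].
rewrite /from_subspace fg => W; rewrite nbhsE => -[N [oN Nx] NW].
have cK : closed (g @` (~` N)).
  apply: compact_closed => //; apply: continuous_compact.
    exact: continuous_subspaceT.
  exact: (subclosed_compact (open_closedC oN) cT).
apply: (@filterS _ (nbhs (g x)) _ (~` (g @` (~` N)))).
  move=> y nKy [z _ gz]; apply: NW; rewrite -gz fg; apply: contrapT => nNz.
  by apply: nKy; exists z.
apply: open_nbhs_nbhs; split; first exact: closed_openC.
by move=> [z nNz gzx]; apply: nNz; rewrite -(fg z) gzx fg.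
Qed.

(** * Homeomorphisms with the interval and the circle *)

Section Conclusion.
Context {R : realType} {X : pseudoMetricType R}.
Context (hX : hausdorff_space X) (cpt : compact [set: X]).

Lemma arc_like_is_arc (p q : X) : arc_like [set: X] p q -> @is_arc R X.
Proof.
move=> /(arc_parametrization hX cpt)[g [cg gp gq g_inj gE]].
have [f fP] : {f : R -> X & forall t, t \in `[0, 1]%R -> g (f t) = t}.
  apply: (@choice _ _ (fun t x => t \in `[0, 1]%R -> g x = t)) => t.
  have [t01|nt01] := pselect (t \in `[0, 1]%R); last by exists p.
  have : [set` `[0, 1]%R] t by [].
  by rewrite -gE => -[x _ gx]; exists x.
have g01 x : g x \in `[0, 1]%R.
  by have : [set g x | x in [set: X]] (g x) by [exists x]; rewrite gE.
have fg x : f (g x) = x by apply: g_inj => //; rewrite fP.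
have {}cg : continuous g by exact/continuous_subspace_setT.
exists f, g; split => //.
rewrite -gE; exact: (compact_inverse_continuous cpt (@norm_hausdorff R R) cg fg).
Qed.

(** The ordinate of the upper unit circle at abscissa [1 - 2 * t]; as [t] goes from 0 to 1, the half
    circle is traced from (1, 0) to (-1, 0). *)
Definition half_circle (t : R) := Num.sqrt (1 - (1 - 2 * t) ^+ 2).

Lemma half_circle_continuous : continuous half_circle.
Proof.
move=> t; apply: (@continuous_comp _ _ _ (fun t : R => 1 - (1 - 2 * t) ^+ 2)).
  apply: cvgB; first exact: cvg_cst.
  apply: (@cvgM _ _ _ _ (fun t : R => 1 - 2 * t) (fun t : R => 1 - 2 * t)).
    by apply: cvgB; [exact: cvg_cst|apply: cvgM; [exact: cvg_cst|exact: cvg_id]].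
  by apply: cvgB; [exact: cvg_cst|apply: cvgM; [exact: cvg_cst|exact: cvg_id]].
exact: sqrt_continuous.
Qed.

Lemma half_circle_sqr (t : R) : t \in `[0, 1]%R ->
  half_circle t ^+ 2 = 1 - (1 - 2 * t) ^+ 2.
Proof.
by rewrite in_itv/= => /andP[t0 t1]; rewrite sqr_sqrtr//; nra.
Qed.

Lemma half_circle_eq0 (t : R) : t \in `[0, 1]%R -> half_circle t = 0 -> t = 0 \/ t = 1.
Proof.
move=> t01 ht; have := half_circle_sqr t01; rewrite ht expr0n/= => /esym H.
have /eqP : t * (1 - t) = 0 by move: H; rewrite expr2; nra.
by rewrite mulf_eq0 subr_eq0 => /orP[/eqP|/eqP]; [left|right].
Qed.

(** One arc is sent to the upper and the other to the lower half of the circle. The two maps agree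
    at [p] and [q], where the ordinate vanishes, and paste along closed sets. *)
Lemma cut_pair_is_simple_closed_curve (p q : X) (U V : set X) :
  cut_pair p q U V -> arc_like (closure U) p q -> arc_like (closure V) p q ->
  @is_simple_closed_curve R X.
Proof.
move=> [oU oV _ _ [_ _ UV0 UVpq [clU clV]]].
move=> /(arc_parametrization hX cpt)[h1 [ch1 h1p h1q h1_inj h1E]].
move=> /(arc_parametrization hX cpt)[h2 [ch2 h2p h2q h2_inj h2E]].
have h1_01 x : closure U x -> h1 x \in `[0, 1]%R.
  by move=> Ux; have : [set` `[0, 1]%R] (h1 x) by [rewrite -h1E; exists x].
have h2_01 x : closure V x -> h2 x \in `[0, 1]%R.
  by move=> Vx; have : [set` `[0, 1]%R] (h2 x) by [rewrite -h2E; exists x].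
have UVT x : closure U x \/ closure V x.
  rewrite clU clV; have [|npq] := pselect ([set p; q] x); first by left; right.
  by have : (U `|` V) x by [rewrite -UVpq]; move=> [|]; [left; left|right; left].
have clUV x : closure U x -> closure V x -> x = p \/ x = q.
  rewrite clU clV => -[Ux|//] [Vx|//].
  by have : (U `&` V) x by []; rewrite UV0.
have hc0 : half_circle 0 = 0 by rewrite /half_circle mulr0 subr0 expr1n subrr sqrtr0.
have hc1 : half_circle 1 = 0.
  by rewrite /half_circle (_ : 1 - 2 * 1 = -1 :> R) ?sqrrN ?expr1n ?subrr ?sqrtr0//; lra.
pose g1 x : R * R := (1 - 2 * h1 x, half_circle (h1 x)).
pose g2 x : R * R := (1 - 2 * h2 x, - half_circle (h2 x)).
pose g x := if pselect (closure U x) then g1 x else g2 x.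
have gU x : closure U x -> g x = g1 x by move=> Ux; rewrite /g; case: pselect.
have gV x : closure V x -> g x = g2 x.
  move=> Vx; rewrite /g; case: pselect => //= Ux; rewrite /g1 /g2.
  by have [->|->] := clUV _ Ux Vx; rewrite ?h1p ?h1q ?h2p ?h2q ?hc0 ?hc1 oppr0.
have abscissa_cvg (h : X -> R) (F : set_system X) (FF : Filter F) (a : R) :
    h y @[y --> F] --> a -> 1 - 2 * h y @[y --> F] --> 1 - 2 * a.
  by move=> ch; apply: cvgB; [exact: cvg_cst|apply: cvgM => //; exact: cvg_cst].
have ordinate_cvg (h : X -> R) (F : set_system X) (FF : Filter F) (a : R) :
    h y @[y --> F] --> a -> half_circle (h y) @[y --> F] --> half_circle a.
  by move=> ch; apply: (cvg_comp _ _ ch); exact: half_circle_continuous.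
have cg1 : {within closure U, continuous g1}.
  apply/subspace_continuousP => x Ux.
  have ch := (subspace_continuousP _ _).1 ch1 x Ux.
  exact: (cvg_pair (abscissa_cvg _ _ _ _ ch) (ordinate_cvg _ _ _ _ ch)).
have cg2 : {within closure V, continuous g2}.
  apply/subspace_continuousP => x Vx.
  have ch := (subspace_continuousP _ _).1 ch2 x Vx.
  exact: (cvg_pair (abscissa_cvg _ _ _ _ ch) (cvgN (ordinate_cvg _ _ _ _ ch))).
have cg : continuous g.
  apply/continuous_subspace_setT.
  have -> : [set: X] = closure U `|` closure V.
    by apply/seteqP; split => // x _; exact: UVT.
  apply: withinU_continuous; [exact: closed_closure|exact: closed_closure| |].
    by apply: subspace_eq_continuous cg1 => x /set_mem Ux; rewrite /from_subspace gU.
  by apply: subspace_eq_continuous cg2 => x /set_mem Vx; rewrite /from_subspace gV.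
have g_circle x : unit_circle (g x).
  have [Ux|Vx] := UVT x; rewrite /unit_circle/= ?(gU _ Ux) ?(gV _ Vx)/=.
    by rewrite half_circle_sqr ?h1_01//; lra.
  by rewrite sqrrN half_circle_sqr ?h2_01//; lra.
(* A value shared by both halves has ordinate 0, being both nonnegative and nonpositive, so its
   parameter is 0 or 1. *)
have opp x y : closure U x -> closure V y -> g1 x = g2 y -> x = y.
  move=> Ux Vy [hxy hc].
  have {}hxy : h1 x = h2 y by lra.
  have c0 : half_circle (h2 y) = 0.
    have : 0 <= half_circle (h1 x) by exact: sqrtr_ge0.
    have : 0 <= half_circle (h2 y) by exact: sqrtr_ge0.
    by rewrite hc; lra.
  have clUp : closure U p by rewrite clU; right; left.
  have clUq : closure U q by rewrite clU; right; right.
  have clVp : closure V p by rewrite clV; right; left.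
  have clVq : closure V q by rewrite clV; right; right.
  have [y0|y1] := half_circle_eq0 (h2_01 _ Vy) c0.
    have -> : x = p by apply: h1_inj => //; rewrite hxy y0 h1p.
    by apply: h2_inj => //; rewrite h2p y0.
  have -> : x = q by apply: h1_inj => //; rewrite hxy y1 h1q.
  by apply: h2_inj => //; rewrite h2q y1.
have g_inj x y : g x = g y -> x = y.
  have [Ux|Vx] := UVT x; have [Uy|Vy] := UVT y.
  - by rewrite !gU// => -[hxy _]; apply: h1_inj => //; lra.
  - by rewrite gU// gV//; exact: opp.
  - by rewrite gV// gU// => /esym /opp ->.
  - by rewrite !gV// => -[hxy _]; apply: h2_inj => //; lra.
have g_surj v : unit_circle v -> exists x, g x = v.
  case: v => a b; rewrite /unit_circle/= => ab.
  have t01 : (1 - a) / 2 \in `[0, 1]%R by rewrite in_itv/=; apply/andP; split; nra.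
  have ta : 1 - 2 * ((1 - a) / 2) = a by lra.
  have hcb : half_circle ((1 - a) / 2) = `|b|.
    by rewrite /half_circle ta -ab addrC addKr sqrtr_sqr.
  have [b0|b0] := leP 0 b.
    have : [set` `[0, 1]%R] ((1 - a) / 2) by [].
    rewrite -h1E => -[x Ux hx]; exists x.
    by rewrite gU// /g1 hx ta hcb ger0_norm.
  have : [set` `[0, 1]%R] ((1 - a) / 2) by [].
  rewrite -h2E => -[x Vx hx]; exists x.
  by rewrite gV// /g2 hx ta hcb ltr0_norm// opprK.
have [f fP] : {f : R * R -> X & forall v, unit_circle v -> g (f v) = v}.
  apply: (@choice _ _ (fun v x => unit_circle v -> g x = v)) => v.
  have [/g_surj[x gx]|nv] := pselect (unit_circle v); first by exists x.
  by exists p.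
have fg x : f (g x) = x by apply: g_inj; rewrite fP.
exists f, g; split => //.
have -> : unit_circle = range g.
  apply/seteqP; split => [v /g_surj[x gx]|_ [x _ <-]//].
  by exists x.
exact: (compact_inverse_continuous cpt (@norm_hausdorff R (R * R)%type) cg fg).
Qed.

End Conclusion.

(** * The dichotomy: a cut point leads to an arc, none to a circle *)

Theorem theorem1 (R : realType) (X : pseudoMetricType R)
  (hX : hausdorff_space X)
  (cpt : compact [set: X]) (conn : connected [set: X])
  (nontriv : exists x y : X, x <> y)
  (lc : @locally_connected_space X)
  (hcl : closed_in_CX (@NCstar X)) :
  @is_arc R X \/ @is_simple_closed_curve R X.
Proof.
have [[c cutc]|noncut] := pselect (exists c : X, ~ connected (~` [set c])).
  left; have [p [q [pq irr]]] := cut_point_irreducible hX cpt conn lc hcl cutc.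
  exact: (arc_like_is_arc hX cpt (irreducible_arc_like hX conn lc pq irr)).
have {}noncut (x : X) : connected (~` [set x]).
  by apply: contrapT => cutx; apply: noncut; exists x.
right; have [p [q pq]] := nontriv.
have [U [V UV]] := cut_pair_exists hX cpt conn lc hcl noncut pq.
apply: (cut_pair_is_simple_closed_curve hX cpt UV).
  exact: (cut_pair_arc_like hX cpt conn lc hcl noncut pq UV).
exact: (cut_pair_arc_like hX cpt conn lc hcl noncut pq (cut_pairC UV)).
Qed.
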